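(* In the space $\mathbb{R}^4$, the Klein--Gordon equation $$\frac{\partial^2 U}{\partial x_0^2}-\frac{\partial^2 U}{\partial x_1^2}-\frac{\partial^2 U}{\partial x_2^2}-\frac{\partial^2 U}{\partial x_3^2}+\mathfrak{m}\,U=0,\qquad \mathfrak{m}\in\mathbb{C},$$ has an infinite-dimensional family of exact solutions of the form $$U_r(x_0,x_1,x_2,x_3)=e^{\xi_0}\,\widetilde{\mathcal{A}}_r,\qquad r=0,1,2,\ldots,$$ or, equivalently, of the form $$\frac{1}{2\pi i}\int_\Gamma e^tA_r\,dt,\qquad r=0,1,2,\ldots,$$ where $r$ can increase to infinity. Here $\Gamma$ is a closed Jordan rectifiable curve in the complex plane that surrounds the point $\xi_0$; the functions $A_r$ are defined by $$A_0=\frac{1}{t-\xi_0},\qquad A_r=\frac{1}{t-\xi_0}\left(\xi_rA_0+\xi_{r-1}A_1+\cdots+\xi_1A_{r-1}\right),\quad r=1,2,\ldots;$$ and the polynomials $\widetilde{\mathcal{A}}_r$ are defined by $\widetilde{\mathcal{A}}_0=1$ and the recurrence relations $$\widetilde{\mathcal{A}}_r=\xi_r\widetilde{\mathcal{A}}_0+\frac{r-1}{r}\,\xi_{r-1}\widetilde{\mathcal{A}}_1+\frac{r-2}{r}\,\xi_{r-2}\widetilde{\mathcal{A}}_2+\cdots+\frac{1}{r}\,\xi_1\widetilde{\mathcal{A}}_{r-1},\quad r=1,2,\ldots$$ (or, equivalently, by $\widetilde{\mathcal{A}}_0=1$ and $\widetilde{\mathcal{A}}_r=PA_r$ for $r\ge1$,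 with the operator $P$ described in the context). Moreover, the variables $\xi_r$ are of the form $$\xi_r=k_rx_0+m_rx_1+g_rx_2+d_rx_3,\qquad r=0,1,2,\ldots,$$ where $m_r,g_r,d_r$ for $r=0,1,2,\ldots$ are arbitrary complex numbers, and $k_r$ for each fixed $r=0,1,2,\ldots$ are determined by the system $$B_0-C_0-G_0-D_0+\mathfrak{m}=0,\qquad B_r-C_r-G_r-D_r=0,\quad r=1,2,\ldots,$$ whose coefficients $B_r,C_r,G_r,D_r$ are given in the context.
   Context: $U$ denotes a complex-valued function of the real variables $x_0,x_1,x_2,x_3$. For complex numbers $a_0,\dots,a_r$ put $B_r(a_0,\dots,a_r)=\sum_{j=0}^{r}a_ja_{r-j}$ (so $B_0=a_0^2$, $B_1=2a_0a_1$, $B_2=a_1^2+2a_0a_2$, and so on). In the system, $B_r=B_r(k_0,\dots,k_r)$, $C_r=B_r(m_0,\dots,m_r)$, $G_r=B_r(g_0,\dots,g_r)$, $D_r=B_r(d_0,\dots,d_r)$. Thus the first equation of the system, $k_0^2-m_0^2-g_0^2-d_0^2+\mathfrak{m}=0$, is quadratic with respect to $k_0$, and for each $r\ge1$ the equation with index $r$ is linear with respect to $k_r$. For $r\ge1$, $A_r$ is a linear combination of the powers $(t-\xi_0)^{-s}$, $s=2,\dots,r+1$, with coefficients that are polynomials in $\xi_1,\dots,\xi_r$. The linear operator $P$ replaces each power $(t-\xi_0)^s$ by $(s-1)!$, for $s\in\{2,3,\dots,r+1\}$. For example, $P\left(\frac{\xi_3}{(t-\xi_0)^2}+\frac{2\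xi_1\xi_2}{(t-\xi_0)^3}+\frac{\xi_1^3}{(t-\xi_0)^4}\right)=\xi_3+\xi_1\xi_2+\frac{\xi_1^3}{3!}$.
   Formalization: That the system determines the k_r for arbitrary m_r, g_r, d_r is claimed only for a root k_0 ≠ 0 of the first equation (if k_0 = 0, the later equations may have no solution); Γ is taken to be positively oriented. *)

(* Defs.v *)
From Stdlib Require Import Reals Factorial Lia.
From Coquelicot Require Import Coquelicot.
Open Scope C_scope.

Definition Cexp (z : C) : C :=
  (exp (fst z) * cos (snd z), exp (fst z) * sin (snd z))%R.

(** * Course-of-values recursion *)

(* [below F n] holds the first [n] terms (and 0 afterwards) of the sequence
   [u] such that [u n = F n u] when [F n] only looks at terms of index < n. *)
Fixpoint below (F : nat -> (nat -> C) -> C) (n : nat) : nat -> C :=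
  match n with
  | O => fun _ => 0
  | S n' => let u := below F n' in
            fun j => if Nat.eqb j n' then F n' u else u j
  end.

Definition cov_rec (F : nat -> (nat -> C) -> C) (n : nat) : C :=
  F n (below F n).

Lemma below_eq F n j : (j < n)%nat -> below F n j = cov_rec F j.
Proof.
  induction n as [|n IH]; intros Hj; [lia|]; simpl.
  destruct (Nat.eqb_spec j n) as [->|Hne]; [reflexivity | apply IH; lia].
Qed.

(** * The functions A_r and the polynomials of the family *)

Definition Afun (xi : nat -> C) (r : nat) (t : C) : C :=
  cov_rec (fun r u =>
    match r with
    | O => / (t - xi 0%nat)
    | S _ => / (t - xi 0%nat) * sum_n_m (fun j => xi j * u (r - j)%nat) 1 r
    end) r.

Definition Apoly (xi : nat -> C) (r : nat) : C :=
  cov_rec (fun r u =>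
    match r with
    | O => 1
    | S _ => sum_n_m (fun j =>
               RtoC (INR j / INR r) * xi j * u (r - j)%nat) 1 r
    end) r.

Lemma Afun_0 xi t : Afun xi 0 t = / (t - xi 0%nat).
Proof. reflexivity. Qed.

Lemma Afun_rec xi r t : (1 <= r)%nat ->
  Afun xi r t =
  / (t - xi 0%nat) * sum_n_m (fun j => xi j * Afun xi (r - j) t) 1 r.
Proof.
  destruct r as [|r]; [lia|]; intros _.
  unfold Afun at 1, cov_rec; f_equal; apply sum_n_m_ext_loc; intros j Hj.
  rewrite below_eq by lia; reflexivity.
Qed.

Lemma Apoly_0 xi : Apoly xi 0 = 1.
Proof. reflexivity. Qed.

Lemma Apoly_rec xi r : (1 <= r)%nat ->
  Apoly xi r =
  sum_n_m (fun j => RtoC (INR j / INR r) * xi j * Apoly xi (r - j)) 1 r.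
Proof.
  destruct r as [|r]; [lia|]; intros _.
  unfold Apoly at 1, cov_rec; apply sum_n_m_ext_loc; intros j Hj.
  rewrite below_eq by lia; reflexivity.
Qed.

(* Graph of the linear operator P on the span of the functions (t - xi0)^(-s),
   2 <= s <= N: it sends (t - xi0)^(-s) to 1/(s-1)!.  These functions are
   linearly independent, so [f] determines [c] on 2..N, hence also [v]. *)
Definition is_P (xi0 : C) (N : nat) (f : C -> C) (v : C) : Prop :=
  exists c : nat -> C,
    (forall t : C, t <> xi0 ->
       f t = sum_n_m (fun s => c s / (t - xi0) ^ s) 2 N) /\
    v = sum_n_m (fun s => c s / RtoC (INR (fact (s - 1)))) 2 N.

(** * Curves in the complex plane, parametrized by [0, 1] *)

Definition I01 (s : R) : Prop := (0 <= s <= 1)%R.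

(* p 0 <= ... <= p (n+1), i.e. n+1 subintervals *)
Definition is_partition (n : nat) (p : nat -> R) : Prop :=
  p 0%nat = 0%R /\ p (S n) = 1%R /\
  forall i, (i <= n)%nat -> (p i <= p (S i))%R.

Definition closed_jordan (gam : R -> C) : Prop :=
  continuous_on I01 gam /\ gam 0%R = gam 1%R /\
  forall s t, (0 <= s < 1)%R -> (0 <= t < 1)%R -> gam s = gam t -> s = t.

Definition rectifiable (gam : R -> C) : Prop :=
  exists L : R, forall n p, is_partition n p ->
    (sum_n (fun i => Cmod (gam (p (S i)) - gam (p i))%C) n <= L)%R.

Definition on_curve (gam : R -> C) (z : C) : Prop :=
  exists s, I01 s /\ gam s = z.

Definition connected_set (S : C -> Prop) : Prop :=
  forall V W : C -> Prop, open V -> open W ->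
    (forall z, S z -> V z \/ W z) ->
    (forall z, S z -> V z -> W z -> False) ->
    (exists z, S z /\ V z) -> (exists z, S z /\ W z) -> False.

(* z is off the curve, and its connected component in the complement of the
   curve (the union of the connected sets through z) is bounded. *)
Definition surrounds (gam : R -> C) (z : C) : Prop :=
  ~ on_curve gam z /\
  exists M : R, forall S : C -> Prop,
    connected_set S -> S z -> (forall w, S w -> ~ on_curve gam w) ->
    forall w, S w -> (Cmod w <= M)%R.

(* Winding number as total increment of a continuous argument of gam - z. *)
Definition winding_number (gam : R -> C) (z : C) (n : Z) : Prop :=
  ~ on_curve gam z /\
  exists theta : R -> R,
    continuous_on I01 theta /\
    (forall s, I01 s ->
       gam s - z = RtoC (Cmod (gam s - z)) * Cexp (Ci * RtoC (theta s))) /\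
    (theta 1 - theta 0 = 2 * PI * IZR n)%R.

Definition positively_oriented (gam : R -> C) : Prop :=
  forall z, surrounds gam z -> winding_number gam z 1.

(* Line integral of f along gam equals v, as the limit of the sums
   f(gam(q_i)) (gam(p_{i+1}) - gam(p_i)) as the mesh tends to 0. *)
Definition is_line_integral (gam : R -> C) (f : C -> C) (v : C) : Prop :=
  forall eps : R, (0 < eps)%R ->
  exists delta : R, (0 < delta)%R /\
  forall (n : nat) (p q : nat -> R), is_partition n p ->
    (forall i, (i <= n)%nat ->
       (p i <= q i <= p (S i) /\ p (S i) - p i < delta)%R) ->
    (Cmod (sum_n (fun i =>
       f (gam (q i)) * (gam (p (S i)) - gam (p i)))%C n - v) < eps)%R.

(** * The Klein-Gordon equation *)

Definition is_second_derive (f : R -> C) (x : R) (l : C) : Prop :=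
  exists f' : R -> C,
    (forall y, @is_derive R_AbsRing C_R_NormedModule f y (f' y)) /\
    @is_derive R_AbsRing C_R_NormedModule f' x l.

Definition solves_KG (mm : C) (U : R -> R -> R -> R -> C) : Prop :=
  forall x0 x1 x2 x3 : R, exists u0 u1 u2 u3 : C,
    is_second_derive (fun s => U s x1 x2 x3) x0 u0 /\
    is_second_derive (fun s => U x0 s x2 x3) x1 u1 /\
    is_second_derive (fun s => U x0 x1 s x3) x2 u2 /\
    is_second_derive (fun s => U x0 x1 x2 s) x3 u3 /\
    u0 - u1 - u2 - u3 + mm * U x0 x1 x2 x3 = 0.

(* B_r(a_0, ..., a_r) *)
Definition Bcoef (a : nat -> C) (r : nat) : C :=
  sum_n (fun j => a j * a (r - j)%nat) r.

Definition KG_system (mm : C) (k m g d : nat -> C) : Prop :=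
  Bcoef k 0 - Bcoef m 0 - Bcoef g 0 - Bcoef d 0 + mm = 0 /\
  forall r, (1 <= r)%nat ->
    Bcoef k r - Bcoef m r - Bcoef g r - Bcoef d r = 0.

Definition xi (k m g d : nat -> C) (x0 x1 x2 x3 : R) (r : nat) : C :=
  k r * x0 + m r * x1 + g r * x2 + d r * x3.

Definition KG_U (k m g d : nat -> C) (r : nat) (x0 x1 x2 x3 : R) : C :=
  Cexp (xi k m g d x0 x1 x2 x3 0) * Apoly (xi k m g d x0 x1 x2 x3) r.

(** * Infinite-dimensional families of functions on R^4 *)

Definition lin_indep (n : nat) (f : nat -> R -> R -> R -> R -> C) : Prop :=
  forall c : nat -> C,
    (forall x0 x1 x2 x3, sum_n (fun i => c i * f i x0 x1 x2 x3) n = RtoC 0) ->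
    forall i, (i <= n)%nat -> c i = 0.

Definition infinite_dimensional
    (F : (R -> R -> R -> R -> C) -> Prop) : Prop :=
  forall n, exists f : nat -> R -> R -> R -> R -> C,
    (forall i, (i <= n)%nat -> F (f i)) /\ lin_indep n f.

(* Main.v *)
Require Import Defs.
From Stdlib Require Import Reals Factorial Lra Lia Wf_nat.
From Stdlib Require Import FunctionalExtensionality ClassicalEpsilon.
From Coquelicot Require Import Coquelicot.
Open Scope C_scope.

(** Everything follows from generating series. Let X be the formal power series
    with coefficients xi_1, xi_2, ... and constant term 0. The recurrences for
    A_r and for the polynomials say that their generating series are
    [1 / (tau - X)], where tau = t - xi_0, and [exp X]; both are combinations of
    the powers of X, with weights [/ tau ^ (s + 1)] and [/ s!] (lemmas
    [Afun_expansion] and [Apoly_expansion]). Comparing the weights gives the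
    description by the operator P, and it reduces the contour integral to
    the residue of exp t / (t - xi_0)^(s+1), which is exp xi_0 / s!.

    The functions U_r are thus the coefficients of
    exp (k x_0 + m x_1 + g x_2 + d x_3), where k, m, g, d are formal series.
    Differentiation with respect to x_0 multiplies this series by k
    ([is_derive_wave]), so the Klein-Gordon operator multiplies it by
    k^2 - m^2 - g^2 - d^2 + mm, and the system says exactly that this series
    vanishes. The family is infinite-dimensional because, for a suitable choice
    of the parameters, differentiation with respect to x_0 lowers the index
    of U_r by one ([waves_independent]).

    The residues are computed on a curve that is only continuous and
    rectifiable, so there is no velocity to integrate. The winding number
    supplies a continuous logarithm l of gam - z. Relations between
    increments, such as dl = dgam / (gam - z) and
    d (exp (a l)) = a exp (a l) dl, hold with an error that is small compared
    with the increment of gam, and by rectifiability such a relation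
    determines a line integral ([is_line_integral_differential]). This gives
    the integrals of all integer powers of t - z, and the exponential is then a
    uniform limit of its Taylor polynomials on the curve. *)

(* An equality whose type is a canonical structure over C is opaque to the
   tactic ring, which looks for the carrier C itself. *)
Ltac C_eq := match goal with |- ?u = ?v => change (@eq C u v) end.

(** * Formal power series *)

Definition fps := nat -> C.
Definition fzero : fps := fun _ => 0.
Definition fconst (c : C) : fps := fun n => match n with O => c | S _ => 0 end.
Definition fadd (a b : fps) : fps := fun n => a n + b n.
Definition fopp (a : fps) : fps := fun n => - a n.
Definition fsub (a b : fps) : fps := fun n => a n - b n.
Definition fmul (a b : fps) : fps :=
  fun n => sum_n (fun j => a j * b (n - j)%nat) n.
Definition fshift (a : fps) : fps := fun n => a (S n).

(** Equality is stated in C here and below, so that the conclusions and the side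
    conditions can be closed by ring. *)
Lemma Csum_n_ext (u v : nat -> C) n :
  (forall i, (i <= n)%nat -> u i = v i) -> sum_n u n = sum_n v n :> C.
Proof. exact (sum_n_ext_loc u v n). Qed.

Lemma Csum_n_S (u : nat -> C) n : sum_n u (S n) = sum_n u n + u (S n) :> C.
Proof. exact (sum_Sn u n). Qed.

Lemma Csum_n_0 (u : nat -> C) : sum_n u 0 = u 0%nat :> C.
Proof. apply sum_O. Qed.

Lemma Csum_n_Sl (u : nat -> C) n :
  sum_n u (S n) = u 0%nat + sum_n (fun i => u (S i)) n :> C.
Proof.
  induction n as [|n IH]; [now rewrite Csum_n_S, !Csum_n_0|].
  rewrite Csum_n_S, IH, Csum_n_S. ring.
Qed.

Lemma Csum_n_scal (c : C) (u : nat -> C) n :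
  sum_n (fun i => c * u i) n = c * sum_n u n :> C.
Proof. exact (sum_n_mult_l (K := C_Ring) c u n). Qed.

Lemma Csum_n_plus (u v : nat -> C) n :
  sum_n (fun i => u i + v i) n = sum_n u n + sum_n v n :> C.
Proof. exact (sum_n_plus (G := C_AbelianMonoid) u v n). Qed.

Lemma Csum_n_zero (u : nat -> C) n :
  (forall i, (i <= n)%nat -> u i = 0) -> sum_n u n = 0 :> C.
Proof.
  intros H; rewrite (sum_n_ext_loc (G := C_AbelianMonoid) u (fun _ => RtoC 0) n H).
  exact (sum_n_m_const_zero (G := C_AbelianMonoid) 0 n).
Qed.

Lemma Csum_n_m_1 (u : nat -> C) n :
  u 0%nat = 0 -> (1 <= n)%nat -> sum_n_m u 1 n = sum_n u n :> C.
Proof.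
  intros H0 Hn; unfold sum_n.
  rewrite (sum_n_m_Chasles u 0 0 n) by lia.
  rewrite sum_n_n, H0. symmetry; exact (plus_zero_l (G := C_AbelianMonoid) _).
Qed.

Lemma fmul_0 a b : fmul a b 0%nat = a 0%nat * b 0%nat.
Proof. exact (Csum_n_0 (fun j => a j * b (0 - j)%nat)). Qed.

Lemma fmul_Sl a b n :
  fmul a b (S n) = a 0%nat * b (S n) + fmul (fshift a) b n.
Proof. unfold fmul; now rewrite Csum_n_Sl. Qed.

Lemma fmul_Sr a b n :
  fmul a b (S n) = a (S n) * b 0%nat + fmul a (fshift b) n.
Proof.
  unfold fmul; rewrite Csum_n_S, Nat.sub_diag, Cplus_comm; f_equal.
  apply Csum_n_ext; intros j Hj; unfold fshift; do 2 f_equal; lia.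
Qed.

Lemma fmul_comm a b : fmul a b = fmul b a.
Proof.
  apply functional_extensionality; intros n; revert a b.
  induction n as [|n IH]; intros a b.
  - rewrite !fmul_0. apply Cmult_comm.
  - rewrite fmul_Sl, fmul_Sr, IH. ring.
Qed.

Lemma fmul_add_l a b c : fmul (fadd a b) c = fadd (fmul a c) (fmul b c).
Proof.
  apply functional_extensionality; intros n; unfold fmul, fadd.
  rewrite <- Csum_n_plus; apply Csum_n_ext; intros j _; ring.
Qed.

Lemma fmul_scal_l (x : C) a b n : fmul (fun i => x * a i) b n = x * fmul a b n.
Proof.
  unfold fmul; rewrite <- Csum_n_scal; apply Csum_n_ext; intros j _; ring.
Qed.

(** Associativity without exchanging a triangular double sum: shifting turns
    a product into a product with smaller index plus a scalar multiple. *)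
Lemma fmul_assoc a b c : fmul a (fmul b c) = fmul (fmul a b) c.
Proof.
  apply functional_extensionality; intros n; revert a.
  induction n as [|n IH]; intros a.
  - rewrite !fmul_0. ring.
  - rewrite (fmul_Sl a), (fmul_Sl (fmul a b)), (fmul_Sl b), IH.
    replace (fshift (fmul a b)) with
      (fadd (fun i => a 0%nat * fshift b i) (fmul (fshift a) b)).
    + rewrite fmul_add_l; unfold fadd.
      rewrite fmul_scal_l, fmul_0. ring.
    + apply functional_extensionality; intros i; unfold fadd, fshift at 1 3.
      now rewrite fmul_Sl.
Qed.

Lemma fmul_const c a n : fmul (fconst c) a n = c * a n.
Proof.
  destruct n as [|n]; [now rewrite fmul_0|].
  rewrite fmul_Sl; unfold fmul; simpl.
  rewrite Csum_n_zero; [ring|]. intros i _; unfold fshift; simpl; ring.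
Qed.

Lemma fps_ring_theory :
  ring_theory fzero (fconst 1) fadd fmul fsub fopp (@eq fps).
Proof.
  split; intros; try (apply functional_extensionality; intros n;
    unfold fadd, fsub, fopp, fzero; ring).
  - apply functional_extensionality; intros n; rewrite fmul_const; ring.
  - apply fmul_comm.
  - apply fmul_assoc.
  - apply fmul_add_l.
Qed.

Add Ring fps_ring : fps_ring_theory.

(** Formal counterpart of z d/dz. It is preferred to d/dz because it does not
    shift indices: the recurrence for the polynomials becomes a linear
    differential equation, with no special case at index 0. *)
Definition theta (a : fps) : fps := fun n => RtoC (INR n) * a n.

Lemma theta_mul a b : theta (fmul a b) = fadd (fmul (theta a) b) (fmul a (theta b)).
Proof.
  apply functional_extensionality; intros n; unfold theta, fadd, fmul.
  rewrite <- Csum_n_scal, <- Csum_n_plus; apply Csum_n_ext; intros j Hj.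
  rewrite minus_INR, RtoC_minus by exact Hj. ring.
Qed.

(** In a product with a series without constant term, the coefficient of index n
    only sees the coefficients of index < n of the other factor: this is what
    makes the recurrences well founded. *)
Lemma fmul_ext_lt (y b b' : fps) n :
  y 0%nat = 0 -> (forall i, (i < n)%nat -> b i = b' i) -> fmul y b n = fmul y b' n.
Proof.
  intros Hy Hb; apply Csum_n_ext; intros j Hj.
  destruct j as [|j]; [rewrite Hy; ring | rewrite Hb by lia; reflexivity].
Qed.

Lemma fmul_sum (y : fps) (w : nat -> C) (p : nat -> fps) N n :
  fmul y (fun i => sum_n (fun s => w s * p s i) N) n =
  sum_n (fun s => w s * fmul y (p s) n) N.
Proof.
  unfold fmul.
  rewrite (sum_n_ext _ (fun j => sum_n (fun s => y j * (w s * p s (n - j)%nat)) N))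
    by (intros j; now rewrite Csum_n_scal).
  rewrite (sum_n_switch (fun j s => y j * (w s * p s (n - j)%nat))).
  apply Csum_n_ext; intros s _; rewrite <- Csum_n_scal.
  apply Csum_n_ext; intros j _; ring.
Qed.

Fixpoint fpow (x : fps) (s : nat) : fps :=
  match s with O => fconst 1 | S s' => fmul x (fpow x s') end.

Lemma fpow_lt (x : fps) s n : x 0%nat = 0 -> (n < s)%nat -> fpow x s n = 0.
Proof.
  intros Hx; revert n; induction s as [|s IH]; intros n Hn; [lia|]; simpl.
  apply Csum_n_zero; intros j Hj.
  destruct j as [|j]; [rewrite Hx | rewrite IH by lia]; ring.
Qed.

Lemma theta_fpow (x : fps) s :
  theta (fpow x (S s)) = fmul (fconst (INR (S s))) (fmul (theta x) (fpow x s)).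
Proof.
  induction s as [|s IH].
  - simpl fpow; rewrite theta_mul.
    replace (theta (fconst 1)) with fzero by
      (apply functional_extensionality; intros [|n]; unfold theta, fzero; simpl; ring).
    replace (fconst (INR 1)) with (fconst 1) by reflexivity. ring.
  - change (fpow x (S (S s))) with (fmul x (fpow x (S s))).
    rewrite theta_mul, IH, (S_INR (S s)).
    replace (fconst (INR (S s) + 1)%R) with (fadd (fconst (INR (S s))) (fconst 1)) by
      (apply functional_extensionality; intros [|n]; unfold fadd; simpl fconst;
       [now rewrite RtoC_plus | ring]).
    change (fpow x (S s)) with (fmul x (fpow x s)). ring.
Qed.

Definition ftail (x : fps) : fps := fun n => match n with O => 0 | S _ => x n end.

Lemma theta_ftail x : theta (ftail x) = theta x.
Proof.
  apply functional_extensionality; intros [|n]; unfold theta; simpl; ring.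
Qed.

Lemma INR_C_neq_0 n : n <> 0%nat -> RtoC (INR n) <> 0.
Proof. intros H E; apply RtoC_inj in E. now apply (not_0_INR n). Qed.

(** * Expansions in powers of the series of the xi_r *)

(** The factors j / r of the recurrence are those of a logarithmic derivative:
    the polynomials are the coefficients of exp X. *)
Lemma theta_Apoly x : theta (Apoly x) = fmul (theta x) (Apoly x).
Proof.
  apply functional_extensionality; intros [|n].
  - rewrite fmul_0; unfold theta; simpl; ring.
  - unfold theta at 1; rewrite Apoly_rec by lia.
    rewrite Csum_n_m_1; [| simpl; unfold Rdiv; rewrite Rmult_0_l; ring | lia].
    rewrite <- Csum_n_scal; apply Csum_n_ext; intros j _; unfold theta.
    rewrite RtoC_div by (apply not_0_INR; lia).
    field; apply INR_C_neq_0; lia.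
Qed.

(** Since theta X^(s+1) / (s+1)! = theta X * X^s / s!, both sides solve the
    equation of [theta_Apoly]. Terms with s > n vanish, so any N >= n may bound
    the sum; the freedom is used in the induction. *)
Lemma Apoly_expansion (x : nat -> C) N n : (n <= N)%nat ->
  Apoly x n = sum_n (fun s => / RtoC (INR (fact s)) * fpow (ftail x) s n) N.
Proof.
  revert n; induction N as [|N IH]; intros n Hn.
  - replace n with 0%nat by lia; rewrite Csum_n_0, Apoly_0.
    simpl; field; apply INR_C_neq_0; lia.
  - rewrite Csum_n_Sl.
    destruct n as [|n].
    + rewrite Apoly_0, Csum_n_zero.
      * simpl; field; apply INR_C_neq_0; lia.
      * intros i _; rewrite (fpow_lt (ftail x)) by (reflexivity || lia); ring.
    + (* divide the identity for theta by n + 1 *)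
      assert (HS : RtoC (INR (S n)) <> 0) by (apply INR_C_neq_0; lia).
      replace (Apoly x (S n)) with (/ RtoC (INR (S n)) * theta (Apoly x) (S n))
        by (unfold theta; field; exact HS).
      rewrite theta_Apoly.
      rewrite (fmul_ext_lt _ _
        (fun i => sum_n (fun s => / RtoC (INR (fact s)) * fpow (ftail x) s i) N));
        [| unfold theta; simpl; ring | intros i Hi; apply IH; lia].
      rewrite fmul_sum, <- Csum_n_scal. simpl (fpow _ 0 _). rewrite Cmult_0_r, Cplus_0_l.
      apply Csum_n_ext; intros s _.
      assert (Hs : RtoC (INR (S s)) <> 0) by (apply INR_C_neq_0; lia).
      assert (Hf : RtoC (INR (fact s)) <> 0) by (apply INR_C_neq_0, fact_neq_0).
      pose proof (f_equal (fun f => f (S n)) (theta_fpow (ftail x) s)) as E.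
      cbv beta in E; rewrite fmul_const, theta_ftail in E; unfold theta at 1 in E.
      replace (fmul (theta x) (fpow (ftail x) s) (S n)) with
        (/ RtoC (INR (S s)) * (RtoC (INR (S n)) * fpow (ftail x) (S s) (S n)))
        by (rewrite E; field; exact Hs).
      rewrite fact_simpl, mult_INR, RtoC_mult. field; auto.
Qed.

(** Geometric series: the recurrence reads tau A = 1 + X A. *)
Lemma Afun_expansion (x : nat -> C) t N n : t <> x 0%nat -> (n <= N)%nat ->
  Afun x n t = sum_n (fun s => / (t - x 0%nat) ^ S s * fpow (ftail x) s n) N.
Proof.
  intros Ht; assert (Hd : t - x 0%nat <> 0) by
    (intros E; apply Ht; rewrite <- (Cplus_0_l (x 0%nat)), <- E; ring).
  revert n; induction N as [|N IH]; intros n Hn.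
  - replace n with 0%nat by lia; rewrite Csum_n_0, Afun_0; simpl; field; exact Hd.
  - rewrite Csum_n_Sl.
    destruct n as [|n].
    + rewrite Afun_0, Csum_n_zero.
      * simpl; field; exact Hd.
      * intros i _; rewrite (fpow_lt (ftail x)) by (reflexivity || lia); ring.
    + rewrite Afun_rec by lia.
      rewrite (sum_n_m_ext_loc _ (fun j => ftail x j * Afun x (S n - j) t))
        by (intros [|j] Hj; [lia | reflexivity]).
      rewrite Csum_n_m_1 by (simpl; ring || lia).
      change (sum_n _ (S n)) with (fmul (ftail x) (fun i => Afun x i t) (S n)).
      rewrite (fmul_ext_lt _ _
        (fun i => sum_n (fun s => / (t - x 0%nat) ^ S s * fpow (ftail x) s i) N));
        [| reflexivity | intros i Hi; apply IH; lia].
      rewrite fmul_sum, <- Csum_n_scal. simpl (fpow _ 0 _). rewrite Cmult_0_r, Cplus_0_l.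
      apply Csum_n_ext; intros s _. simpl; field.
      split; [apply Cpow_nz|]; exact Hd.
Qed.

(** The term s = 0 of both expansions is the constant term of X^0, which does
    not contribute when r >= 1; hence the poles of order 2 to r + 1. *)
Lemma Afun_is_P (x : nat -> C) r : (1 <= r)%nat ->
  is_P (x 0%nat) (r + 1) (Afun x r) (Apoly x r).
Proof.
  intros Hr; exists (fun s => fpow (ftail x) (s - 1) r).
  assert (H2 : forall v : nat -> C, v 0%nat = 0 ->
            sum_n v r = sum_n_m (fun s => v (s - 1)%nat) 2 (r + 1)).
  { intros v Hv. rewrite <- (Csum_n_m_1 v) by assumption.
    rewrite Nat.add_1_r, <- sum_n_m_S. apply sum_n_m_ext; intros j; f_equal; lia. }
  assert (Hz : fpow (ftail x) 0 r = 0) by (destruct r; [lia | reflexivity]).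
  split.
  - intros t Ht. rewrite (Afun_expansion x t r r Ht (le_n r)), H2 by (rewrite Hz; ring).
    apply sum_n_m_ext_loc; intros s Hs. replace (S (s - 1)) with s by lia.
    apply Cmult_comm.
  - rewrite (Apoly_expansion x r r (le_n r)), H2 by (rewrite Hz; ring).
    apply sum_n_m_ext_loc; intros s Hs. apply Cmult_comm.
Qed.

(** * Derivatives of complex functions of a real variable *)

Notation is_derive_C := (@is_derive R_AbsRing C_R_NormedModule).

Lemma is_derive_C_ext (f g : R -> C) x l :
  (forall t, f t = g t) -> is_derive_C f x l -> is_derive_C g x l.
Proof. exact (is_derive_ext (V := C_R_NormedModule) f g x l). Qed.

Lemma is_derive_C_pair (f : R -> C) x l :
  is_derive_C f x l <->
  is_derive (fun y => fst (f y)) x (fst l) /\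
  is_derive (fun y => snd (f y)) x (snd l).
Proof.
  split.
  - intros H; split.
    + apply (filterdiff_comp' (U := R_NormedModule) (V := C_R_NormedModule)
        (W := R_NormedModule) f (fun z : C => fst z) x (fun y => scal y l) fst H).
      apply filterdiff_linear, (is_linear_fst (U := R_NormedModule) (V := R_NormedModule)).
    + apply (filterdiff_comp' (U := R_NormedModule) (V := C_R_NormedModule)
        (W := R_NormedModule) f (fun z : C => snd z) x (fun y => scal y l) snd H).
      apply filterdiff_linear, (is_linear_snd (U := R_NormedModule) (V := R_NormedModule)).
  - intros [H1 H2].
    apply (is_derive_C_ext (fun y => (fst (f y), snd (f y))));
      [intros t; now destruct (f t)|].
    apply (filterdiff_ext_lin (V := C_R_NormedModule)
      (fun y => (fst (f y), snd (f y))) (fun y => (scal y (fst l), scal y (snd l))));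
      [|intros y; destruct l; reflexivity].
    apply (filterdiff_comp'_2 (T := R_NormedModule) (U := R_NormedModule)
      (V := R_NormedModule) (W := C_R_NormedModule)
      (fun y => fst (f y)) (fun y => snd (f y)) pair x
      (fun y => scal y (fst l)) (fun y => scal y (snd l)) pair H1 H2).
    apply (filterdiff_ext (fun t => t)); [now intros []|].
    apply (filterdiff_ext_lin _ (fun t => t)); [|now intros []].
    apply filterdiff_id.
Qed.

Lemma is_derive_C_const (c : C) x : is_derive_C (fun _ => c) x (RtoC 0).
Proof. exact (is_derive_const (V := C_R_NormedModule) c x). Qed.

Lemma is_derive_C_mult (f g : R -> C) x lf lg :
  is_derive_C f x lf -> is_derive_C g x lg ->
  is_derive_C (fun y => f y * g y) x (lf * g x + f x * lg).
Proof.
  rewrite !is_derive_C_pair; intros [F1 F2] [G1 G2]; split.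
  - assert (H := is_derive_minus _ _ _ _ _
      (is_derive_mult (K := R_AbsRing) _ _ _ _ _ F1 G1 Rmult_comm)
      (is_derive_mult (K := R_AbsRing) _ _ _ _ _ F2 G2 Rmult_comm)).
    replace (fst _) with (minus (plus (mult (fst lf) (fst (g x))) (mult (fst (f x)) (fst lg)))
      (plus (mult (snd lf) (snd (g x))) (mult (snd (f x)) (snd lg)))); [exact H|].
    unfold minus, plus, mult, opp; simpl; ring.
  - assert (H := is_derive_plus _ _ _ _ _
      (is_derive_mult (K := R_AbsRing) _ _ _ _ _ F1 G2 Rmult_comm)
      (is_derive_mult (K := R_AbsRing) _ _ _ _ _ F2 G1 Rmult_comm)).
    replace (snd _) with (plus (plus (mult (fst lf) (snd (g x))) (mult (fst (f x)) (snd lg)))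
      (plus (mult (snd lf) (fst (g x))) (mult (snd (f x)) (fst lg)))); [exact H|].
    unfold plus, mult; simpl; ring.
Qed.

Lemma is_derive_Cexp (f : R -> C) x l :
  is_derive_C f x l -> is_derive_C (fun y => Cexp (f y)) x (l * Cexp (f x)).
Proof.
  rewrite !is_derive_C_pair; intros [F1 F2].
  set (p := fun y : R => fst (f y)); set (q := fun y : R => snd (f y)).
  change (is_derive p x (fst l)) in F1; change (is_derive q x (snd l)) in F2.
  split.
  - apply (is_derive_ext (fun y : R => exp (p y) * cos (q y))%R); [reflexivity|].
    auto_derive; [repeat split; eexists; eauto|].
    change (Derive (fun y => p y) x) with (Derive p x).
    change (Derive (fun y => q y) x) with (Derive q x).
    rewrite (is_derive_unique _ _ _ F1), (is_derive_unique _ _ _ F2).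
    unfold p, q; simpl; ring.
  - apply (is_derive_ext (fun y : R => exp (p y) * sin (q y))%R); [reflexivity|].
    auto_derive; [repeat split; eexists; eauto|].
    change (Derive (fun y => p y) x) with (Derive p x).
    change (Derive (fun y => q y) x) with (Derive q x).
    rewrite (is_derive_unique _ _ _ F1), (is_derive_unique _ _ _ F2).
    unfold p, q; simpl; ring.
Qed.

Lemma is_derive_C_affine (a b : C) x : is_derive_C (fun s => a * RtoC s + b) x a.
Proof. rewrite is_derive_C_pair; simpl; split; auto_derive; trivial; ring. Qed.

Lemma is_derive_C_sum (f : nat -> R -> C) n x d :
  (forall k, (k <= n)%nat -> is_derive_C (f k) x (d k)) ->
  is_derive_C (fun y => sum_n (fun k => f k y) n) x (sum_n d n).
Proof. exact (is_derive_sum_n (V := C_R_NormedModule) f n x d). Qed.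

(** * The Klein-Gordon equation *)

(** The coefficients of the exponential of the full series, constant term
    xi_0 included. *)
Definition wave (x : nat -> C) : fps := fun r => Cexp (x 0%nat) * Apoly x r.

Lemma theta_wave x : theta (wave x) = fmul (theta x) (wave x).
Proof.
  replace (wave x) with (fmul (fconst (Cexp (x 0%nat))) (Apoly x)).
  - rewrite theta_mul, theta_Apoly.
    replace (theta (fconst (Cexp (x 0%nat)))) with fzero; [ring|].
    apply functional_extensionality; intros [|n]; unfold theta, fzero; simpl; ring.
  - apply functional_extensionality; intros n; apply fmul_const.
Qed.

(** Induction on the index through theta W = theta x * W: differentiating the
    right-hand side gives theta a * W + theta x * (a * W), that is
    theta a * W + a * theta W = theta (a * W). *)
Lemma is_derive_wave (x : R -> nat -> C) (a : nat -> C) s r :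
  (forall j, is_derive_C (fun u => x u j) s (a j)) ->
  is_derive_C (fun u => wave (x u) r) s (fmul a (wave (x s)) r).
Proof.
  intros Hx; induction r as [[|r] IH] using lt_wf_ind.
  - rewrite fmul_0. unfold wave at 2; rewrite Apoly_0, Cmult_1_r.
    apply (is_derive_C_ext (fun u => Cexp (x u 0%nat)));
      [intros t; unfold wave; rewrite Apoly_0; apply (eq_sym (Cmult_1_r _)) |].
    apply is_derive_Cexp, Hx.
  - assert (HS : RtoC (INR (S r)) <> 0) by (apply INR_C_neq_0; lia).
    assert (Hdiv : forall b : fps, b (S r) = / RtoC (INR (S r)) * theta b (S r))
      by (intros b; unfold theta; field; exact HS).
    apply (is_derive_C_ext
      (fun u => / RtoC (INR (S r)) * fmul (theta (x u)) (wave (x u)) (S r)));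
      [intros u; rewrite <- theta_wave; exact (eq_sym (Hdiv _)) |].
    rewrite Hdiv, theta_mul, theta_wave.
    replace (fmul a (fmul (theta (x s)) (wave (x s)))) with
      (fmul (theta (x s)) (fmul a (wave (x s)))) by ring.
    (* the shape of the product rule for a constant factor *)
    replace (/ RtoC (INR (S r)) * _) with
      (0 * fmul (theta (x s)) (wave (x s)) (S r) +
       / RtoC (INR (S r)) * fadd (fmul (theta a) (wave (x s)))
         (fmul (theta (x s)) (fmul a (wave (x s)))) (S r)) by ring.
    apply is_derive_C_mult; [apply is_derive_C_const|].
    unfold fadd, fmul at 1 2 3. rewrite <- Csum_n_plus.
    apply is_derive_C_sum; intros [|j] Hj.
    + replace (_ + _) with (RtoC 0) by (unfold theta; simpl; ring).
      apply (is_derive_C_ext (fun _ => RtoC 0));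
        [intros u; unfold theta; simpl INR; ring|apply is_derive_C_const].
    + apply (is_derive_C_mult (fun u => theta (x u) (S j))).
      * unfold theta.
        replace (RtoC (INR (S j)) * a (S j)) with
          (0 * x s (S j) + RtoC (INR (S j)) * a (S j)) by ring.
        apply (is_derive_C_mult (fun _ => RtoC (INR (S j)))); [apply is_derive_C_const | apply Hx].
      * apply IH; lia.
Qed.

Lemma is_second_derive_wave (x : R -> nat -> C) (a : nat -> C) s r :
  (forall u j, is_derive_C (fun v => x v j) u (a j)) ->
  is_second_derive (fun u => wave (x u) r) s (fmul (fmul a a) (wave (x s)) r).
Proof.
  intros Hx; exists (fun u => fmul a (wave (x u)) r); split.
  - intros u; apply is_derive_wave, Hx.
  - replace (fmul (fmul a a) (wave (x s))) with (fmul a (fmul a (wave (x s)))) by ring.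
    unfold fmul at 1 2. apply is_derive_C_sum; intros j _.
    replace (a j * _) with (0 * wave (x s) (r - j)%nat +
      a j * fmul a (wave (x s)) (r - j)%nat) by ring.
    apply (is_derive_C_mult (fun _ => a j)); [apply is_derive_C_const|].
    apply is_derive_wave, Hx.
Qed.

Lemma KG_system_fps mm k m g d :
  KG_system mm k m g d ->
  fadd (fsub (fsub (fsub (fmul k k) (fmul m m)) (fmul g g)) (fmul d d)) (fconst mm) = fzero.
Proof.
  intros [H0 H]; apply functional_extensionality; intros [|r].
  - exact H0.
  - unfold fadd, fsub; simpl; rewrite Cplus_0_r. apply (H (S r)); lia.
Qed.

Lemma KG_U_solves mm k m g d r :
  KG_system mm k m g d -> solves_KG mm (KG_U k m g d r).
Proof.
  intros HS x0 x1 x2 x3. set (X := xi k m g d).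
  assert (Hsec : forall (a b : nat -> C) (x : R -> nat -> C) s,
    (forall u j, x u j = a j * RtoC u + b j) ->
    is_second_derive (fun u => wave (x u) r) s (fmul (fmul a a) (wave (x s)) r)).
  { intros a b x s Hx; apply is_second_derive_wave; intros u j.
    apply (is_derive_C_ext (fun v => a j * RtoC v + b j));
      [intros t; exact (eq_sym (Hx t j)) | apply is_derive_C_affine]. }
  set (W := wave (X x0 x1 x2 x3)).
  exists (fmul (fmul k k) W r), (fmul (fmul m m) W r), (fmul (fmul g g) W r),
    (fmul (fmul d d) W r). repeat split.
  - apply (Hsec k (fun j => m j * x1 + g j * x2 + d j * x3) (fun s => X s x1 x2 x3)).
    intros u j; unfold X, xi; ring.
  - apply (Hsec m (fun j => k j * x0 + g j * x2 + d j * x3) (fun s => X x0 s x2 x3)).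
    intros u j; unfold X, xi; ring.
  - apply (Hsec g (fun j => k j * x0 + m j * x1 + d j * x3) (fun s => X x0 x1 s x3)).
    intros u j; unfold X, xi; ring.
  - apply (Hsec d (fun j => k j * x0 + m j * x1 + g j * x2) (fun s => X x0 x1 x2 s)).
    intros u j; unfold X, xi; ring.
  - change (KG_U k m g d r x0 x1 x2 x3) with (W r).
    rewrite <- fmul_const.
    transitivity (fmul (fadd (fsub (fsub (fsub (fmul k k) (fmul m m)) (fmul g g))
      (fmul d d)) (fconst mm)) W r).
    + replace (fmul (fadd _ _) W) with
        (fadd (fsub (fsub (fsub (fmul (fmul k k) W) (fmul (fmul m m) W))
          (fmul (fmul g g) W)) (fmul (fmul d d) W)) (fmul (fconst mm) W)) by ring.
      reflexivity.
    + rewrite (KG_system_fps _ _ _ _ _ HS). replace (fmul fzero W) with fzero by ring.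
      reflexivity.
Qed.

(** * The system for the coefficients k_r *)

(** Half-angle formulas; the sign of the imaginary part decides which of the
    two conjugate candidates is a root. *)
Lemma Csqrt_exists (z : C) : exists w : C, w ^ 2 = z.
Proof.
  destruct z as [x y].
  set (r := Cmod (x, y)).
  assert (Hr2 : (r * r = x * x + y * y)%R).
  { unfold r, Cmod; simpl. rewrite sqrt_sqrt; [ring|].
    nra. }
  assert (Hr : (0 <= r)%R) by apply Cmod_ge_0.
  assert (Hx : (Rabs x <= r)%R) by apply (re_le_Cmod (x, y)).
  apply Rabs_le_between in Hx.
  set (a := sqrt ((r + x) / 2)). set (b := sqrt ((r - x) / 2)).
  assert (Ha : (a * a = (r + x) / 2)%R) by (apply sqrt_sqrt; lra).
  assert (Hb : (b * b = (r - x) / 2)%R) by (apply sqrt_sqrt; lra).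
  assert (Hab : (2 * a * b = Rabs y)%R).
  { apply Rsqr_inj.
    - pose proof (sqrt_pos ((r + x) / 2)); pose proof (sqrt_pos ((r - x) / 2)).
      fold a in H; fold b in H0; nra.
    - apply Rabs_pos.
    - rewrite <- Rsqr_abs; unfold Rsqr.
      replace (2 * a * b * (2 * a * b))%R with (4 * (a * a) * (b * b))%R by ring.
      rewrite Ha, Hb. nra. }
  destruct (Rle_dec 0 y) as [Hy|Hy].
  - rewrite Rabs_pos_eq in Hab by exact Hy.
    exists (a, b). simpl. unfold Cmult; simpl. f_equal; nra.
  - rewrite Rabs_left in Hab by lra.
    exists (a, (- b)%R). simpl. unfold Cmult; simpl. f_equal; nra.
Qed.

Definition ftrunc (a : fps) (r : nat) : fps :=
  fun j => if Nat.ltb j r then a j else 0.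

(** Only the two extreme terms of the convolution contain the coefficient of
    highest index. *)
Lemma Bcoef_linear (a : nat -> C) n :
  Bcoef a (S n) = 2 * a 0%nat * a (S n) + fmul (ftrunc a (S n)) (ftrunc a (S n)) (S n).
Proof.
  assert (Ht : ftrunc a (S n) (S n) = 0) by (unfold ftrunc; now rewrite Nat.ltb_irrefl).
  unfold Bcoef. destruct n as [|n].
  - unfold fmul. rewrite !Csum_n_S, !Csum_n_0. simpl Nat.sub. rewrite Ht. ring.
  - unfold fmul. rewrite !(Csum_n_Sl _ (S n)), !(Csum_n_S _ n).
    rewrite Nat.sub_0_r, Nat.sub_diag, Ht.
    rewrite (Csum_n_ext (fun i => ftrunc a (S (S n)) (S i) * ftrunc a (S (S n)) (S (S n) - S i)%nat)
      (fun i => a (S i) * a (S (S n) - S i)%nat)); [ring|].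
    intros i Hi; unfold ftrunc.
    now rewrite !(proj2 (Nat.ltb_lt _ _)) by lia.
Qed.

Lemma KG_system_linear mm k m g d n :
  KG_system mm k m g d ->
  2 * k 0%nat * k (S n) = Bcoef m (S n) + Bcoef g (S n) + Bcoef d (S n) -
    fmul (ftrunc k (S n)) (ftrunc k (S n)) (S n).
Proof.
  intros [_ H]; specialize (H (S n) ltac:(lia)); rewrite (Bcoef_linear k n) in H.
  apply Ceq_minus. rewrite <- H. ring.
Qed.

(** Each equation of index >= 1 is linear in its highest unknown with
    coefficient 2 k_0, so the sequence is built, and is unique, by
    course-of-values recursion. *)
Lemma KG_system_solvable mm m g d k0 :
  k0 ^ 2 - m 0%nat ^ 2 - g 0%nat ^ 2 - d 0%nat ^ 2 + mm = 0 -> k0 <> 0 ->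
  exists k : nat -> C,
    (k 0%nat = k0 /\ KG_system mm k m g d) /\
    (forall k' : nat -> C, k' 0%nat = k0 /\ KG_system mm k' m g d ->
       forall r, k' r = k r).
Proof.
  intros H0 Hk0.
  set (F := fun r (u : nat -> C) => match r with
    | O => k0
    | S _ => / (2 * k0) * (Bcoef m r + Bcoef g r + Bcoef d r - fmul u u r)
    end).
  set (k := cov_rec F).
  assert (Hbelow : forall n, below F n = ftrunc k n).
  { intros n; apply functional_extensionality; intros j; unfold ftrunc.
    destruct (Nat.ltb_spec j n) as [Hj|Hj]; [now apply below_eq|].
    clear k. induction n as [|n IH]; [reflexivity|]; simpl.
    destruct (Nat.eqb_spec j n); [lia | apply IH; lia]. }
  exists k; split; [split; [reflexivity | split]|].
  - unfold Bcoef; rewrite !Csum_n_0; change (k 0%nat) with k0.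
    rewrite <- H0; simpl; ring.
  - intros [|r] Hr; [lia|]. rewrite (Bcoef_linear k). change (k 0%nat) with k0.
    replace (k (S r)) with (F (S r) (ftrunc k (S r))) by
      (rewrite <- Hbelow; reflexivity).
    unfold F. field; exact Hk0.
  - intros k' [Hk' HS] r; induction r as [[|r] IH] using lt_wf_ind; [exact Hk'|].
    change (k (S r)) with (F (S r) (below F (S r))). rewrite Hbelow.
    replace (ftrunc k (S r)) with (ftrunc k' (S r)).
    + unfold F. rewrite <- (KG_system_linear mm k' m g d r HS), Hk'.
      field; exact Hk0.
    + apply functional_extensionality; intros j; unfold ftrunc.
      destruct (Nat.ltb_spec j (S r)) as [Hj|Hj]; [now apply IH | reflexivity].
Qed.

(** * Infinite dimension *)

Lemma Cmod_Cexp z : Cmod (Cexp z) = exp (fst z).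
Proof.
  pose proof (exp_pos (fst z)) as Hp.
  pose proof (sin2_cos2 (snd z)) as Hsc; unfold Rsqr in Hsc.
  unfold Cmod, Cexp; simpl.
  replace (_ + _)%R with (exp (fst z) * exp (fst z) *
    (sin (snd z) * sin (snd z) + cos (snd z) * cos (snd z)))%R by ring.
  rewrite Hsc, Rmult_1_r. apply sqrt_square; lra.
Qed.

Lemma Cexp_neq_0 z : Cexp z <> 0.
Proof. apply Cmod_gt_0; rewrite Cmod_Cexp; apply exp_pos. Qed.

Lemma is_derive_C_unique (f : R -> C) x l l' :
  is_derive_C f x l -> is_derive_C f x l' -> l = l'.
Proof.
  rewrite !is_derive_C_pair; intros [H1 H2] [H1' H2'].
  apply is_derive_unique in H1, H2, H1', H2'.
  apply injective_projections; congruence.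
Qed.

Definition formal_X : fps := fun j => match j with 1%nat => 1 | _ => 0 end.

Lemma fmul_formal_X b n : fmul formal_X b (S n) = b n.
Proof.
  rewrite fmul_Sl; simpl. replace (fshift formal_X) with (fconst 1).
  - rewrite fmul_const; ring.
  - apply functional_extensionality; intros [|i]; reflexivity.
Qed.

(** Along x, differentiation maps each wave to the preceding one, so it
    shortens a linear relation; the last remaining function is an exponential,
    which has no zero. *)
Lemma waves_independent (x : R -> nat -> C) n (c : nat -> C) :
  (forall s j, is_derive_C (fun u => x u j) s (formal_X j)) ->
  (forall s, sum_n (fun i => c i * wave (x s) i) n = RtoC 0) ->
  forall i, (i <= n)%nat -> c i = 0.
Proof.
  intros Hx; revert c; induction n as [|n IH]; intros c H.
  - intros i Hi; replace i with 0%nat by lia.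
    specialize (H 0%R); rewrite Csum_n_0 in H. unfold wave in H.
    rewrite Apoly_0, Cmult_1_r in H.
    destruct (Ceq_dec (c 0%nat) 0) as [E|E]; [exact E|].
    now destruct (Cmult_neq_0 _ _ E (Cexp_neq_0 (x 0%R 0%nat))).
  - assert (HS : forall i, (i <= n)%nat -> c (S i) = 0).
    { apply (IH (fun i => c (S i))); intros s.
      apply (is_derive_C_unique (fun u => sum_n (fun i => c i * wave (x u) i) (S n)) s).
      - replace (sum_n _ n) with
          (sum_n (fun i => 0 * wave (x s) i + c i * fmul formal_X (wave (x s)) i) (S n)).
        + apply is_derive_C_sum; intros k Hk.
          apply (is_derive_C_mult (fun _ => c k)); [apply is_derive_C_const|].
          now apply is_derive_wave.
        + rewrite Csum_n_Sl, fmul_0. simpl formal_X.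
          rewrite (Csum_n_ext _ (fun i => c (S i) * wave (x s) i));
            [C_eq; ring|].
          intros i _; rewrite fmul_formal_X; ring.
      - apply (is_derive_C_ext (fun _ => RtoC 0)); [intros t; symmetry; apply H|].
        apply is_derive_C_const. }
    intros [|i] Hi; [|apply HS; lia].
    specialize (H 0%R); rewrite Csum_n_Sl, Csum_n_zero in H
      by (intros j Hj; rewrite HS by exact Hj; ring).
    unfold wave in H; rewrite Apoly_0, Cmult_1_r, Cplus_0_r in H.
    destruct (Ceq_dec (c 0%nat) 0) as [E|E]; [exact E|].
    now destruct (Cmult_neq_0 _ _ E (Cexp_neq_0 (x 0%R 0%nat))).
Qed.

(** With k = m = the formal variable, d = 0 and a constant g with g^2 = mm, the
    system holds identically, and xi_1 = x_0 + x_1 is the only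
    xi_r with r >= 1 that does not vanish. *)
Lemma infinite_dimensional_family mm :
  exists k m g d : nat -> C, KG_system mm k m g d /\
    infinite_dimensional (fun U => exists r : nat, U = KG_U k m g d r).
Proof.
  destruct (Csqrt_exists mm) as [g0 Hg0].
  exists formal_X, formal_X, (fconst g0), fzero; split.
  - assert (Hd : forall r, Bcoef fzero r = 0).
    { intros r; apply Csum_n_zero; intros; unfold fzero; ring. }
    assert (Hg : forall r, Bcoef (fconst g0) r = fconst mm r).
    { intros r; change (fmul (fconst g0) (fconst g0) r = fconst mm r).
      rewrite fmul_const; destruct r; simpl; [rewrite <- Hg0; simpl|]; ring. }
    split; [|intros [|r] Hr; [lia|]]; rewrite Hd, Hg; simpl fconst; ring.
  - intros n; exists (KG_U formal_X formal_X (fconst g0) fzero); split; [eauto|].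
    intros c Hc.
    apply (waves_independent (fun s => xi formal_X formal_X (fconst g0) fzero s 0 0 0) n c).
    + intros s j; apply (is_derive_C_ext (fun u => formal_X j * RtoC u + 0));
        [|apply is_derive_C_affine].
      intros t; unfold xi, fzero; ring.
    + intros s; exact (Hc s 0%R 0%R 0%R).
Qed.

(** * The Taylor remainder of the exponential *)

Lemma Cexp_plus a b : Cexp (a + b) = Cexp a * Cexp b.
Proof.
  unfold Cexp, Cmult; simpl. rewrite exp_plus, cos_plus, sin_plus.
  f_equal; ring.
Qed.

Lemma Cexp_0 : Cexp 0 = 1.
Proof. unfold Cexp; simpl. rewrite exp_0, cos_0, sin_0. unfold RtoC; f_equal; ring. Qed.

Lemma Cexp_INR n z : Cexp (RtoC (INR n) * z) = Cexp z ^ n.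
Proof.
  induction n as [|n IH].
  - simpl INR; rewrite Cmult_0_l; exact Cexp_0.
  - rewrite S_INR, RtoC_plus, Cmult_plus_distr_r, Cmult_1_l, Cexp_plus, IH.
    simpl; ring.
Qed.

Lemma exp_monotone a b : (a <= b)%R -> (exp a <= exp b)%R.
Proof. intros [H|H]; [left; now apply exp_increasing | rewrite H; lra]. Qed.

Lemma Cmod_Cexp_le z : (Cmod (Cexp z) <= exp (Cmod z))%R.
Proof.
  rewrite Cmod_Cexp. apply exp_monotone.
  eapply Rle_trans; [apply Rle_abs | exact (re_le_Cmod z)].
Qed.

(** There is no mean value equality for complex functions. The real one is applied
    to |D| h - Re (conj D * f), where D is the increment of f, so that the
    increment of the subtracted function is |D|^2. *)
Lemma mean_value_bound (f f' : R -> C) (h h' : R -> R) :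
  (forall u, is_derive_C f u (f' u)) -> (forall u, is_derive h u (h' u)) ->
  (forall u, (0 <= u <= 1)%R -> (Cmod (f' u) <= h' u)%R) ->
  (Cmod (f 1%R - f 0%R) <= h 1%R - h 0%R)%R.
Proof.
  intros Hf Hh Hle.
  set (D := f 1%R - f 0%R).
  (* phi is nondecreasing on [0, 1], and its increment is |D| (h 1 - h 0) - |D|^2 *)
  set (phi := fun u => (Cmod D * h u - (fst D * fst (f u) + snd D * snd (f u)))%R).
  set (phi' := fun u => (Cmod D * h' u - (fst D * fst (f' u) + snd D * snd (f' u)))%R).
  assert (Hphi : forall u, is_derive phi u (phi' u)).
  { intros u. destruct (proj1 (is_derive_C_pair _ _ _) (Hf u)) as [F1 F2].
    apply (is_derive_minus (V := R_NormedModule)).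
    - apply is_derive_scal, Hh.
    - apply (is_derive_plus (V := R_NormedModule)); apply is_derive_scal; assumption. }
  assert (Hpos : forall u, (0 <= u <= 1)%R -> (0 <= phi' u)%R).
  { intros u Hu. unfold phi'.
    assert (H1 : (fst D * fst (f' u) + snd D * snd (f' u) <= Cmod D * Cmod (f' u))%R).
    { rewrite <- (Cmod_conj D), <- Cmod_mult.
      eapply Rle_trans; [apply Rle_abs|].
      eapply Rle_trans; [|apply re_le_Cmod].
      right; f_equal; simpl; ring. }
    assert (H2 := Rmult_le_compat_l _ _ _ (Cmod_ge_0 D) (Hle u Hu)). lra. }
  destruct (MVT_gen phi 0 1 phi') as (c & Hc & Heq).
  - intros x _; apply Hphi.
  - intros x _; apply continuity_pt_filterlim.
    apply (ex_derive_continuous phi x); eexists; apply Hphi.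
  - rewrite Rmin_left, Rmax_right in Hc by lra. specialize (Hpos c Hc).
    assert (HD : (Cmod D * Cmod D = fst D * fst D + snd D * snd D)%R).
    { unfold Cmod; rewrite sqrt_sqrt; [ring|]. nra. }
    assert (HD1 : (fst D = fst (f 1%R) - fst (f 0%R))%R) by (simpl; ring).
    assert (HD2 : (snd D = snd (f 1%R) - snd (f 0%R))%R) by (simpl; ring).
    assert (Hge : (Cmod D * Cmod D <= Cmod D * (h 1%R - h 0%R))%R).
    { rewrite HD. unfold phi in Heq. rewrite HD1 at 2. rewrite HD2 at 2. nra. }
    destruct (Cmod_ge_0 D) as [Hlt|E].
    + apply (Rmult_le_reg_l (Cmod D)); assumption.
    + rewrite <- E.
      destruct (MVT_gen h 0 1 h') as (c' & Hc' & Heq').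
      * intros x _; apply Hh.
      * intros x _; apply continuity_pt_filterlim.
        apply (ex_derive_continuous h x); eexists; apply Hh.
      * rewrite Rmin_left, Rmax_right in Hc' by lra.
        assert (H3 := Hle c' Hc'); assert (H4 := Cmod_ge_0 (f' c')). lra.
Qed.

(** Subtracting the terms one by one keeps the derivative of the remainder of
    order n + 1 equal to the remainder of order n. *)
Fixpoint exp_rem (n : nat) (w : C) : C :=
  match n with
  | O => Cexp w
  | S n' => exp_rem n' w - w ^ n' / RtoC (INR (fact n'))
  end.

Lemma exp_rem_0 n : exp_rem (S n) 0 = 0.
Proof.
  induction n as [|n IH].
  - simpl; rewrite Cexp_0; field.
  - change (exp_rem (S n) 0 - 0 ^ S n / RtoC (INR (fact (S n))) = 0).
    rewrite IH, Cpow_S; unfold Cdiv; ring.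
Qed.

Lemma is_derive_C_minus (f g : R -> C) x lf lg :
  is_derive_C f x lf -> is_derive_C g x lg ->
  is_derive_C (fun y => f y - g y) x (lf - lg).
Proof. exact (is_derive_minus (V := C_R_NormedModule) f g x lf lg). Qed.

Lemma is_derive_C_pow (w : C) n u :
  is_derive_C (fun v => (RtoC v * w) ^ S n / RtoC (INR (fact (S n)))) u
    (w * ((RtoC u * w) ^ n / RtoC (INR (fact n)))).
Proof.
  assert (H1 : forall v, is_derive_C (fun v => RtoC v * w) v w).
  { intros v; apply (is_derive_C_ext (fun v => w * RtoC v + 0));
      [intros t; ring | apply is_derive_C_affine]. }
  assert (H : is_derive_C (fun v => (RtoC v * w) ^ S n) u
    (RtoC (INR (S n)) * w * (RtoC u * w) ^ n)).
  { induction n as [|n IH].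
    - apply (is_derive_C_ext (fun v => RtoC v * w)); [intros t; simpl; ring|].
      replace (_ * w * _) with w by (simpl; ring). apply H1.
    - apply (is_derive_C_ext (fun v => RtoC v * w * (RtoC v * w) ^ S n)); [reflexivity|].
      replace (RtoC (INR (S (S n))) * w * (RtoC u * w) ^ S n) with
        (w * (RtoC u * w) ^ S n + (RtoC u * w) * (RtoC (INR (S n)) * w * (RtoC u * w) ^ n)).
      + apply is_derive_C_mult; [apply H1 | exact IH].
      + rewrite (S_INR (S n)), RtoC_plus. simpl Cpow. ring. }
  assert (Hf : RtoC (INR (fact n)) <> 0) by (apply INR_C_neq_0, fact_neq_0).
  assert (Hn : RtoC (INR (S n)) <> 0) by (apply INR_C_neq_0; lia).
  replace (w * _) with ((RtoC (INR (S n)) * w * (RtoC u * w) ^ n) * / RtoC (INR (fact (S n)))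
    + (RtoC u * w) ^ S n * 0).
  - apply (is_derive_C_mult (fun v => (RtoC v * w) ^ S n) (fun _ => / RtoC (INR (fact (S n))))); [exact H|].
    apply is_derive_C_const.
  - rewrite fact_simpl, mult_INR, RtoC_mult. field; auto.
Qed.

Lemma is_derive_exp_rem n w u :
  is_derive_C (fun v => exp_rem (S n) (RtoC v * w)) u (w * exp_rem n (RtoC u * w)).
Proof.
  induction n as [|n IH].
  - simpl. replace (w * _) with (w * Cexp (RtoC u * w) - 0) by ring.
    apply is_derive_C_minus; [|apply is_derive_C_const].
    apply is_derive_Cexp.
    apply (is_derive_C_ext (fun v => w * RtoC v + 0));
      [intros t; ring | apply is_derive_C_affine].
  - replace (w * exp_rem (S n) (RtoC u * w)) with
      (w * exp_rem n (RtoC u * w) - w * ((RtoC u * w) ^ n / RtoC (INR (fact n))))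
      by (simpl; ring).
    apply (is_derive_C_minus (fun v => exp_rem (S n) (RtoC v * w)));
      [exact IH | apply is_derive_C_pow].
Qed.

(** Induction on n along the segment from 0 to w, where the remainder of order
    n + 1 has derivative w times the remainder of order n. *)
Lemma exp_rem_bound n w :
  (Cmod (exp_rem n w) <= exp (Cmod w) * Cmod w ^ n / INR (fact n))%R.
Proof.
  revert w; induction n as [|n IH]; intros w.
  - simpl; unfold Rdiv; rewrite Rmult_1_r, Rinv_1, Rmult_1_r. apply Cmod_Cexp_le.
  - assert (Hf : (0 < INR (fact n))%R) by apply INR_fact_lt_0.
    assert (Hn : (0 < INR (S n))%R) by (apply lt_0_INR; lia).
    pose proof (Cmod_ge_0 w) as Hw.
    pose (h := fun u : R => (exp (Cmod w) * Cmod w ^ S n / INR (fact (S n)) * u ^ S n)%R).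
    pose (h' := fun u : R => (exp (Cmod w) * Cmod w ^ S n / INR (fact n) * u ^ n)%R).
    assert (H := mean_value_bound (fun v => exp_rem (S n) (RtoC v * w))
      (fun u => w * exp_rem n (RtoC u * w)) h h' (is_derive_exp_rem n w)).
    cbv beta in H; rewrite Cmult_0_l, Cmult_1_l, exp_rem_0 in H.
    replace (exp_rem (S n) w - 0) with (exp_rem (S n) w) in H by ring.
    replace (h 1%R - h 0%R)%R with (exp (Cmod w) * Cmod w ^ S n / INR (fact (S n)))%R in H.
    2:{ unfold h; rewrite pow1, pow_i by lia; ring. }
    apply H.
    + intros u; unfold h.
      replace (h' u) with (exp (Cmod w) * Cmod w ^ S n / INR (fact (S n)) *
        (INR (S n) * 1 * u ^ pred (S n)))%R.
      * apply is_derive_scal.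
        apply (is_derive_pow (fun v : R => v) (S n) u 1%R), (is_derive_id (K := R_AbsRing)).
      * unfold h'; rewrite fact_simpl, mult_INR; simpl pred. field; lra.
    + intros u Hu. rewrite Cmod_mult; unfold h'.
      assert (Hm : Cmod (RtoC u * w) = (u * Cmod w)%R).
      { rewrite Cmod_mult, Cmod_R, Rabs_pos_eq by lra; reflexivity. }
      assert (B := IH (RtoC u * w)). rewrite Hm, Rpow_mult_distr in B.
      assert (He : (exp (u * Cmod w) <= exp (Cmod w))%R) by (apply exp_monotone; nra).
      apply Rle_trans with (Cmod w * (exp (Cmod w) * (u ^ n * Cmod w ^ n) / INR (fact n)))%R.
      * apply Rmult_le_compat_l; [exact Hw|]. eapply Rle_trans; [exact B|].
        unfold Rdiv. apply Rmult_le_compat_r; [left; now apply Rinv_0_lt_compat|].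
        apply Rmult_le_compat_r; [|exact He].
        apply Rmult_le_pos; apply pow_le; lra.
      * right; simpl; field; lra.
Qed.

Lemma Cexp_near_0 h : (Cmod h <= 1)%R ->
  (Cmod (Cexp h - 1) <= 3 * Cmod h)%R /\
  (Cmod (Cexp h - 1 - h) <= 3 * Cmod h * Cmod h)%R.
Proof.
  intros Hh. pose proof (Cmod_ge_0 h) as H0.
  assert (He : (exp (Cmod h) <= 3)%R).
  { eapply Rle_trans; [apply exp_monotone, Hh | apply exp_le_3]. }
  split.
  - assert (B := exp_rem_bound 1 h). simpl in B.
    replace (Cexp h - 1 / 1) with (Cexp h - 1) in B by field.
    eapply Rle_trans; [exact B|]. nra.
  - assert (B := exp_rem_bound 2 h). simpl in B.
    replace (Cexp h - 1 / 1 - h * 1 / 1) with (Cexp h - 1 - h) in B by field.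
    eapply Rle_trans; [exact B|]. pose proof (exp_pos (Cmod h)). nra.
Qed.

(** * Line integrals *)

Lemma Cmod_sum_n_le (c : R) (u : nat -> C) (v : nat -> R) n :
  (forall i, (i <= n)%nat -> (Cmod (u i) <= c * v i)%R) ->
  (Cmod (sum_n u n) <= c * sum_n v n)%R.
Proof.
  induction n as [|n IH]; intros H.
  - rewrite Csum_n_0, sum_O. now apply H.
  - rewrite Csum_n_S, sum_Sn. unfold plus; simpl.
    eapply Rle_trans; [apply Cmod_triangle|].
    assert (H1 := IH (fun i Hi => H i (le_S _ _ Hi))); assert (H2 := H (S n) (le_n _)).
    lra.
Qed.

Lemma sum_n_telescope (a : nat -> C) n :
  sum_n (fun i => a (S i) - a i) n = a (S n) - a 0%nat :> C.
Proof.
  induction n as [|n IH]; [apply Csum_n_0|]. rewrite Csum_n_S, IH. ring.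
Qed.

Lemma partition_I01 n p : is_partition n p ->
  forall i, (i <= S n)%nat -> I01 (p i).
Proof.
  intros (H0 & H1 & Hp).
  assert (Hm : forall i j, (i <= j <= S n)%nat -> (p i <= p j)%R).
  { intros i j [Hij Hj]. induction Hij as [|j Hij IH]; [lra|].
    apply Rle_trans with (p j); [apply IH; lia | apply Hp; lia]. }
  intros i Hi; unfold I01; rewrite <- H0, <- H1; split; apply Hm; lia.
Qed.

(** What a partition with tags provides for the terms of a sum: all the points at
    which the curve is evaluated are parameters of the curve. *)
Definition tagged (n : nat) (p q : nat -> R) : Prop :=
  forall i, (i <= n)%nat -> I01 (p i) /\ I01 (p (S i)) /\ I01 (q i).

Lemma partition_tagged n p q :
  is_partition n p -> (forall i, (i <= n)%nat -> (p i <= q i <= p (S i))%R) ->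
  tagged n p q.
Proof.
  intros Hp Hq i Hi.
  assert (A1 := partition_I01 n p Hp i ltac:(lia)).
  assert (A2 := partition_I01 n p Hp (S i) ltac:(lia)).
  specialize (Hq i Hi). unfold I01 in *. lra.
Qed.

Lemma is_line_integral_ext gam f g v :
  (forall s, I01 s -> f (gam s) = g (gam s)) ->
  is_line_integral gam f v -> is_line_integral gam g v.
Proof.
  intros Hfg H eps Heps. destruct (H eps Heps) as (delta & Hd & K).
  exists delta; split; [exact Hd|]. intros n p q Hp Hq.
  rewrite <- (Csum_n_ext (fun i => f (gam (q i)) * (gam (p (S i)) - gam (p i)))).
  - now apply K.
  - intros i Hi. rewrite Hfg; [reflexivity|].
    apply (partition_tagged n p q Hp (fun i Hi => proj1 (Hq i Hi))); exact Hi.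
Qed.

Lemma is_line_integral_plus gam f g u v :
  is_line_integral gam f u -> is_line_integral gam g v ->
  is_line_integral gam (fun t => f t + g t) (u + v).
Proof.
  intros Hf Hg eps Heps.
  destruct (Hf (eps / 2)%R ltac:(lra)) as (d1 & Hd1 & K1).
  destruct (Hg (eps / 2)%R ltac:(lra)) as (d2 & Hd2 & K2).
  exists (Rmin d1 d2); split; [now apply Rmin_glb_lt|]. intros n p q Hp Hq.
  assert (A1 := K1 n p q Hp (fun i Hi => conj (proj1 (Hq i Hi))
    (Rlt_le_trans _ _ _ (proj2 (Hq i Hi)) (Rmin_l _ _)))).
  assert (A2 := K2 n p q Hp (fun i Hi => conj (proj1 (Hq i Hi))
    (Rlt_le_trans _ _ _ (proj2 (Hq i Hi)) (Rmin_r _ _)))).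
  rewrite (Csum_n_ext _ (fun i => f (gam (q i)) * (gam (p (S i)) - gam (p i)) +
    g (gam (q i)) * (gam (p (S i)) - gam (p i)))) by (intros; ring).
  rewrite Csum_n_plus.
  set (S1 := sum_n _ n) in *. set (S2 := sum_n (fun i => g _ * _) n) in *.
  replace (S1 + S2 - (u + v)) with ((S1 - u) + (S2 - v)) by ring.
  eapply Rle_lt_trans; [apply Cmod_triangle|]. lra.
Qed.

Lemma is_line_integral_scal gam f c v :
  is_line_integral gam f v -> is_line_integral gam (fun t => c * f t) (c * v).
Proof.
  intros Hf eps Heps. pose proof (Cmod_ge_0 c) as Hc.
  destruct (Hf (eps / (Cmod c + 1))%R) as (d & Hd & K); [apply Rdiv_lt_0_compat; lra|].
  exists d; split; [exact Hd|]. intros n p q Hp Hq.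
  rewrite (Csum_n_ext _ (fun i => c * (f (gam (q i)) * (gam (p (S i)) - gam (p i)))))
    by (intros; ring).
  rewrite Csum_n_scal.
  specialize (K n p q Hp Hq). set (S1 := sum_n _ n) in *.
  replace (c * S1 - c * v) with (c * (S1 - v)) by ring. rewrite Cmod_mult.
  apply (Rmult_lt_compat_r (Cmod c + 1)) in K; [|lra].
  unfold Rdiv in K. rewrite Rmult_assoc, Rinv_l, Rmult_1_r in K by lra.
  pose proof (Cmod_ge_0 (S1 - v)). lra.
Qed.

Lemma is_line_integral_0 gam : is_line_integral gam (fun _ => 0) 0.
Proof.
  intros eps Heps; exists 1%R; split; [lra|]. intros n p q _ _.
  rewrite Csum_n_zero by (intros; ring).
  replace (0 - 0) with (RtoC 0) by ring. now rewrite Cmod_0.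
Qed.

Lemma is_line_integral_sum gam (f : nat -> C -> C) v n :
  (forall i, (i <= n)%nat -> is_line_integral gam (f i) (v i)) ->
  is_line_integral gam (fun t => sum_n (fun i => f i t) n) (sum_n v n).
Proof.
  induction n as [|n IH]; intros H.
  - rewrite Csum_n_0. apply (is_line_integral_ext gam (f 0%nat)); [|now apply H].
    intros s _; symmetry; apply Csum_n_0.
  - rewrite Csum_n_S.
    apply (is_line_integral_ext gam (fun t => sum_n (fun i => f i t) n + f (S n) t)).
    + intros s _; symmetry; apply (Csum_n_S (fun i => f i (gam s))).
    + apply is_line_integral_plus; [apply IH; intros i Hi; apply H; lia | apply H; lia].
Qed.

Lemma rectifiable_bound gam : rectifiable gam -> exists L : R, (0 <= L)%R /\
  forall n p, is_partition n p ->
    (sum_n (fun i => Cmod (gam (p (S i)) - gam (p i))%C) n <= L)%R.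
Proof.
  intros [L HL]; exists (Rmax L 0); split; [apply Rmax_r|].
  intros n p Hp; eapply Rle_trans; [exact (HL n p Hp) | apply Rmax_l].
Qed.

(** The length of the curve bounds the effect of a uniform change of the
    integrand on every sum. *)
Lemma is_line_integral_uniform_limit gam f v :
  rectifiable gam ->
  (forall eps, (0 < eps)%R -> exists g, is_line_integral gam g v /\
     forall s, I01 s -> (Cmod (f (gam s) - g (gam s)) <= eps)%R) ->
  is_line_integral gam f v.
Proof.
  intros Hrect H eps Heps.
  destruct (rectifiable_bound gam Hrect) as (L & HL0 & HL).
  destruct (H (eps / 2 / (L + 1))%R) as (g & Hg & Hfg); [apply Rdiv_lt_0_compat; lra|].
  destruct (Hg (eps / 2)%R ltac:(lra)) as (d & Hd & K).
  exists d; split; [exact Hd|]. intros n p q Hp Hq.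
  specialize (K n p q Hp Hq). specialize (HL n p Hp).
  assert (B : (Cmod (sum_n (fun i => (f (gam (q i)) - g (gam (q i))) *
      (gam (p (S i)) - gam (p i)))%C n) <=
      eps / 2 / (L + 1) * sum_n (fun i => Cmod (gam (p (S i)) - gam (p i))%C) n)%R).
  { apply Cmod_sum_n_le; intros i Hi. rewrite Cmod_mult.
    apply Rmult_le_compat_r; [apply Cmod_ge_0|]. apply Hfg.
    apply (partition_tagged n p q Hp (fun i Hi => proj1 (Hq i Hi))); exact Hi. }
  assert (B2 : (eps / 2 / (L + 1) * sum_n (fun i => Cmod (gam (p (S i)) - gam (p i))%C) n
      <= eps / 2)%R).
  { apply Rle_trans with (eps / 2 / (L + 1) * (L + 1))%R.
    - apply Rmult_le_compat_l; [apply Rlt_le, Rdiv_lt_0_compat; lra | lra].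
    - right; field; lra. }
  rewrite (Csum_n_ext _ (fun i => (f (gam (q i)) - g (gam (q i))) *
      (gam (p (S i)) - gam (p i)) + g (gam (q i)) * (gam (p (S i)) - gam (p i))))
    by (intros; ring).
  rewrite Csum_n_plus.
  set (S1 := sum_n (fun i => (_ - _) * _) n) in *. set (S2 := sum_n (fun i => g _ * _) n) in *.
  replace (S1 + S2 - v) with (S1 + (S2 - v)) by ring.
  eapply Rle_lt_trans; [apply Cmod_triangle|]. lra.
Qed.

(** * Differentials along a curve *)

(** The relation dPhi = phi dW between increments, with an error that is small
    compared with the increment of W rather than that of the parameter, so that
    it makes sense for curves without velocity. The two endpoints and the tag
    move independently near s0, as they do in a Riemann-Stieltjes sum. *)
Definition is_differential (Phi phi W : R -> C) : Prop :=
  forall s0, I01 s0 -> forall eps : R, (0 < eps)%R -> exists delta : R, (0 < delta)%R /\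
    forall s t q, I01 s -> I01 t -> I01 q ->
      (Rabs (s - s0) < delta)%R -> (Rabs (t - s0) < delta)%R -> (Rabs (q - s0) < delta)%R ->
      (Cmod (Phi t - Phi s - phi q * (W t - W s)) <= eps * Cmod (W t - W s))%R.

Definition continuous_I01 (f : R -> C) : Prop :=
  forall s0, I01 s0 -> forall eps : R, (0 < eps)%R -> exists delta : R, (0 < delta)%R /\
    forall s, I01 s -> (Rabs (s - s0) < delta)%R -> (Cmod (f s - f s0) < eps)%R.

(** The local radii become a uniform one by compactness of [0, 1]: radii that
    are halved beforehand absorb the distance from the tag to the centre. *)
Lemma is_differential_uniform Phi phi W eps :
  is_differential Phi phi W -> (0 < eps)%R ->
  exists delta : R, (0 < delta)%R /\
    forall s t q, I01 s -> I01 t -> (s <= q <= t)%R -> (t - s < delta)%R ->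
      (Cmod (Phi t - Phi s - phi q * (W t - W s)) <= eps * Cmod (W t - W s))%R.
Proof.
  intros H Heps.
  assert (Hch : forall s0, {d : posreal | I01 s0 ->
    forall s t q, I01 s -> I01 t -> I01 q ->
      (Rabs (s - s0) < 2 * d)%R -> (Rabs (t - s0) < 2 * d)%R -> (Rabs (q - s0) < 2 * d)%R ->
      (Cmod (Phi t - Phi s - phi q * (W t - W s)) <= eps * Cmod (W t - W s))%R}).
  { intros s0; apply constructive_indefinite_description.
    destruct (classic (I01 s0)) as [Hs0|Hs0].
    - destruct (H s0 Hs0 eps Heps) as (d & Hd & K).
      assert (Hd2 : (0 < d / 2)%R) by lra.
      exists (mkposreal _ Hd2); intros _; simpl.
      replace (2 * (d / 2))%R with d by field. exact K.
    - exists (mkposreal 1 Rlt_0_1); tauto. }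
  destruct (compactness_value_1d 0 1 (fun s0 => proj1_sig (Hch s0))) as [d Hd].
  exists d; split; [apply cond_pos|]. intros s t q Hs Ht Hq Hst.
  assert (Iq : I01 q) by (unfold I01 in *; lra).
  apply Rnot_lt_le; intros Hlt. apply (Hd q Iq). intros (s0 & Hs0 & Hqs & Hds).
  destruct (Hch s0) as [d0 K]; simpl in Hqs, Hds.
  apply Rlt_not_le in Hlt; apply Hlt.
  apply Rabs_def2 in Hqs.
  apply K; try assumption; apply Rabs_def1; lra.
Qed.

(** The sum telescopes up to errors that add up to at most a small multiple of the
    length of the curve. *)
Lemma is_line_integral_differential gam f Phi :
  rectifiable gam -> is_differential Phi (fun s => f (gam s)) gam ->
  is_line_integral gam f (Phi 1%R - Phi 0%R).
Proof.
  intros Hrect H eps Heps.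
  destruct (rectifiable_bound gam Hrect) as (L & HL0 & HL).
  assert (He : (0 < eps / (L + 1))%R) by (apply Rdiv_lt_0_compat; lra).
  destruct (is_differential_uniform _ _ _ _ H He) as (d & Hd & K).
  exists d; split; [exact Hd|]. intros n p q Hp Hq. specialize (HL n p Hp).
  assert (Htag := partition_tagged n p q Hp (fun i Hi => proj1 (Hq i Hi))).
  destruct Hp as (H0 & H1 & _). rewrite <- H0, <- H1.
  rewrite <- (sum_n_telescope (fun i => Phi (p i))).
  rewrite <- Cmod_opp.
  replace (- _) with (sum_n (fun i => Phi (p (S i)) - Phi (p i) -
    f (gam (q i)) * (gam (p (S i)) - gam (p i))) n).
  - apply Rle_lt_trans with
      (eps / (L + 1) * sum_n (fun i => Cmod (gam (p (S i)) - gam (p i))%C) n)%R.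
    + apply Cmod_sum_n_le; intros i Hi.
      destruct (Htag i Hi) as (I1 & I2 & I3), (Hq i Hi). now apply K.
    + apply Rle_lt_trans with (eps / (L + 1) * L)%R.
      * apply Rmult_le_compat_l; lra.
      * apply Rmult_lt_reg_r with (L + 1)%R; [lra|].
        replace (eps / (L + 1) * L * (L + 1))%R with (eps * L)%R by (field; lra). nra.
  - rewrite (Csum_n_ext _ (fun i => (Phi (p (S i)) - Phi (p i)) +
      (-1) * (f (gam (q i)) * (gam (p (S i)) - gam (p i))))) by (intros; ring).
    rewrite Csum_n_plus, Csum_n_scal. C_eq; ring.
Qed.

(** Factor e^b - e^a - e^c (b - a) as
    e^a (e^(b-a) - 1 - (b - a)) + e^c (e^(a-c) - 1) (b - a): both terms are
    of second order. *)
Lemma is_differential_exp (l : R -> C) : continuous_I01 l ->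
  is_differential (fun s => Cexp (l s)) (fun s => Cexp (l s)) l.
Proof.
  intros Hl s0 Hs0 eps Heps.
  set (M := exp (Cmod (l s0) + 1)).
  assert (HM : (0 < M)%R) by apply exp_pos.
  (* each of the two second-order terms is at most 6 M eta |dl| *)
  set (eta := Rmin (1 / 2) (eps / (12 * M))).
  assert (Heta : (0 < eta)%R).
  { apply Rmin_glb_lt; [lra | apply Rdiv_lt_0_compat; lra]. }
  destruct (Hl s0 Hs0 eta Heta) as (d & Hd & K).
  exists d; split; [exact Hd|]. intros s t q Is It Iq Hs Ht Hq.
  apply K in Hs, Ht, Hq; try assumption.
  assert (Hm1 : (eta <= 1 / 2)%R) by apply Rmin_l.
  assert (Hm2 : (M * (12 * eta) <= eps)%R).
  { apply Rle_trans with (M * (12 * (eps / (12 * M))))%R.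
    - apply Rmult_le_compat_l; [lra|]. apply Rmult_le_compat_l; [lra|]. apply Rmin_r.
    - right; field; lra. }
  assert (Hdist : forall a b, (Cmod (a - l s0) < eta)%R -> (Cmod (b - l s0) < eta)%R ->
    (Cmod (a - b) <= 2 * eta)%R).
  { intros a b Ha Hb. replace (a - b) with ((a - l s0) + - (b - l s0)) by ring.
    eapply Rle_trans; [apply Cmod_triangle|]. rewrite Cmod_opp. lra. }
  assert (Hts := Hdist _ _ Ht Hs). assert (Hsq := Hdist _ _ Hs Hq).
  destruct (Cexp_near_0 (l t - l s)) as [_ B1]; [lra|].
  destruct (Cexp_near_0 (l s - l q)) as [B2 _]; [lra|].
  assert (B3 : (Cmod (Cexp (l s)) <= M)%R).
  { eapply Rle_trans; [apply Cmod_Cexp_le | apply exp_monotone].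
    replace (l s) with (l s0 + (l s - l s0)) by ring.
    eapply Rle_trans; [apply Cmod_triangle|]. lra. }
  assert (B4 : (Cmod (Cexp (l q)) <= M)%R).
  { eapply Rle_trans; [apply Cmod_Cexp_le | apply exp_monotone].
    replace (l q) with (l s0 + (l q - l s0)) by ring.
    eapply Rle_trans; [apply Cmod_triangle|]. lra. }
  replace (Cexp (l t) - Cexp (l s) - Cexp (l q) * (l t - l s)) with
    (Cexp (l s) * (Cexp (l t - l s) - 1 - (l t - l s)) +
     Cexp (l q) * ((Cexp (l s - l q) - 1) * (l t - l s))).
  - eapply Rle_trans; [apply Cmod_triangle|]. rewrite !Cmod_mult.
    set (x := Cmod (l t - l s)) in *. assert (Hx : (0 <= x)%R) by apply Cmod_ge_0.
    apply Rle_trans with (M * (6 * eta * x) + M * (6 * eta * x))%R; [|nra].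
    apply Rplus_le_compat; apply Rmult_le_compat; try apply Cmod_ge_0; try assumption.
    + eapply Rle_trans; [exact B1|]. nra.
    + apply Rmult_le_pos; [apply Cmod_ge_0 | exact Hx].
    + apply Rmult_le_compat_r; [exact Hx|]. lra.
  - replace (Cexp (l t)) with (Cexp (l s) * Cexp (l t - l s)) by
      (rewrite <- Cexp_plus; f_equal; ring).
    replace (Cexp (l s)) with (Cexp (l q) * Cexp (l s - l q)) by
      (rewrite <- Cexp_plus; f_equal; ring). ring.
Qed.

Lemma continuous_I01_exp (l : R -> C) : continuous_I01 l ->
  continuous_I01 (fun s => Cexp (l s)).
Proof.
  intros Hl s0 Hs0 eps Heps.
  set (M := Cmod (Cexp (l s0))). assert (HM : (0 <= M)%R) by apply Cmod_ge_0.
  destruct (Hl s0 Hs0 (Rmin 1 (eps / (3 * M + 1)))) as (d & Hd & K).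
  { apply Rmin_glb_lt; [lra | apply Rdiv_lt_0_compat; lra]. }
  exists d; split; [exact Hd|]. intros s Is Hs; specialize (K s Is Hs).
  assert (K1 := Rlt_le_trans _ _ _ K (Rmin_l _ _)).
  assert (K2 := Rlt_le_trans _ _ _ K (Rmin_r _ _)).
  destruct (Cexp_near_0 (l s - l s0)) as [B _]; [lra|].
  replace (Cexp (l s)) with (Cexp (l s0) * Cexp (l s - l s0)) by
    (rewrite <- Cexp_plus; f_equal; ring).
  replace (_ - _) with (Cexp (l s0) * (Cexp (l s - l s0) - 1)) by ring.
  rewrite Cmod_mult. fold M.
  apply (Rmult_lt_compat_r (3 * M + 1)) in K2; [|lra].
  unfold Rdiv in K2; rewrite Rmult_assoc, Rinv_l, Rmult_1_r in K2 by lra.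
  pose proof (Cmod_ge_0 (l s - l s0)). nra.
Qed.

Lemma continuous_I01_scal (c : C) (l : R -> C) : continuous_I01 l ->
  continuous_I01 (fun s => c * l s).
Proof.
  intros Hl s0 Hs0 eps Heps. pose proof (Cmod_ge_0 c) as Hc.
  destruct (Hl s0 Hs0 (eps / (Cmod c + 1))%R) as (d & Hd & K);
    [apply Rdiv_lt_0_compat; lra|].
  exists d; split; [exact Hd|]. intros s Is Hs; specialize (K s Is Hs).
  replace (_ - _) with (c * (l s - l s0)) by ring. rewrite Cmod_mult.
  apply (Rmult_lt_compat_r (Cmod c + 1)) in K; [|lra].
  unfold Rdiv in K. rewrite Rmult_assoc, Rinv_l, Rmult_1_r in K by lra.
  pose proof (Cmod_ge_0 (l s - l s0)). lra.
Qed.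

Lemma continuous_I01_bounded f s0 : continuous_I01 f -> I01 s0 ->
  exists delta : R, (0 < delta)%R /\ forall s, I01 s -> (Rabs (s - s0) < delta)%R ->
    (Cmod (f s) <= Cmod (f s0) + 1)%R.
Proof.
  intros Hf Hs0. destruct (Hf s0 Hs0 1%R Rlt_0_1) as (d & Hd & K).
  exists d; split; [exact Hd|]. intros s Is Hs; specialize (K s Is Hs).
  replace (f s) with (f s0 + (f s - f s0)) by ring.
  eapply Rle_trans; [apply Cmod_triangle|]. lra.
Qed.

(** If dW = phi dl and psi = 1 / phi is continuous, the error, small compared with
    dl, is also small compared with dW, because dl is at most 2 |psi| dW. *)
Lemma is_differential_inverse W phi l psi :
  is_differential W phi l -> continuous_I01 psi ->
  (forall s, I01 s -> phi s * psi s = 1) -> is_differential l psi W.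
Proof.
  intros HW Hpsi Hinv s0 Hs0 eps Heps.
  destruct (continuous_I01_bounded psi s0 Hpsi Hs0) as (d1 & Hd1 & K1).
  set (B := (Cmod (psi s0) + 1)%R) in *.
  assert (HB : (0 < B)%R) by (pose proof (Cmod_ge_0 (psi s0)); unfold B; lra).
  (* the first bound on e absorbs the term in |dl|, the second gives eps *)
  set (e := Rmin (/ (2 * B)) (eps / (2 * B * B))).
  assert (He : (0 < e)%R).
  { apply Rmin_glb_lt; [apply Rinv_0_lt_compat; lra|].
    apply Rdiv_lt_0_compat; [lra | nra]. }
  destruct (HW s0 Hs0 e He) as (d2 & Hd2 & K2).
  exists (Rmin d1 d2); split; [now apply Rmin_glb_lt|].
  intros s t q Is It Iq Hs Ht Hq.
  assert (P := K1 q Iq (Rlt_le_trans _ _ _ Hq (Rmin_l _ _))).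
  assert (Q := K2 s t q Is It Iq (Rlt_le_trans _ _ _ Hs (Rmin_r _ _))
    (Rlt_le_trans _ _ _ Ht (Rmin_r _ _)) (Rlt_le_trans _ _ _ Hq (Rmin_r _ _))).
  assert (E1 : (B * e <= / 2)%R).
  { apply Rle_trans with (B * / (2 * B))%R.
    - apply Rmult_le_compat_l; [lra | apply Rmin_l].
    - right; field; lra. }
  assert (E2 : (2 * B * B * e <= eps)%R).
  { apply Rle_trans with (2 * B * B * (eps / (2 * B * B)))%R.
    - apply Rmult_le_compat_l; [nra | apply Rmin_r].
    - right; field; lra. }
  assert (E : l t - l s - psi q * (W t - W s) =
    - (psi q * (W t - W s - phi q * (l t - l s)))).
  { transitivity (phi q * psi q * (l t - l s) - psi q * (W t - W s)); [|ring].
    rewrite (Hinv q Iq). ring. }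
  assert (R1 : (Cmod (l t - l s - psi q * (W t - W s)) <= B * (e * Cmod (l t - l s)))%R).
  { rewrite E, Cmod_opp, Cmod_mult.
    apply Rmult_le_compat; try apply Cmod_ge_0; assumption. }
  assert (R2 : (Cmod (l t - l s) <= B * Cmod (W t - W s) + B * (e * Cmod (l t - l s)))%R).
  { replace (l t - l s) with (psi q * (W t - W s) + (l t - l s - psi q * (W t - W s)))
      at 1 by ring.
    eapply Rle_trans; [apply Cmod_triangle|]. rewrite Cmod_mult.
    apply Rplus_le_compat; [|exact R1].
    apply Rmult_le_compat_r; [apply Cmod_ge_0 | exact P]. }
  pose proof (Cmod_ge_0 (l t - l s)) as Hx. pose proof (Cmod_ge_0 (W t - W s)) as Hy.
  set (x := Cmod (l t - l s)) in *. set (y := Cmod (W t - W s)) in *.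
  assert (R3 : (x <= 2 * B * y)%R) by nra.
  eapply Rle_trans; [exact R1|].
  apply Rle_trans with (B * (e * (2 * B * y)))%R; [|nra].
  apply Rmult_le_compat_l; [lra|]. apply Rmult_le_compat_l; lra.
Qed.

Lemma is_differential_comp Phi phi l psi W :
  is_differential Phi phi l -> is_differential l psi W ->
  continuous_I01 phi -> continuous_I01 psi ->
  is_differential Phi (fun s => phi s * psi s) W.
Proof.
  intros H1 H2 C1 C2 s0 Hs0 eps Heps.
  destruct (continuous_I01_bounded phi s0 C1 Hs0) as (d1 & Hd1 & K1).
  destruct (continuous_I01_bounded psi s0 C2 Hs0) as (d2 & Hd2 & K2).
  set (B1 := (Cmod (phi s0) + 1)%R) in *. set (B2 := (Cmod (psi s0) + 1)%R) in *.
  assert (HB1 : (0 < B1)%R) by (pose proof (Cmod_ge_0 (phi s0)); unfold B1; lra).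
  assert (HB2 : (0 < B2)%R) by (pose proof (Cmod_ge_0 (psi s0)); unfold B2; lra).
  set (e1 := (eps / (2 * (B2 + 1)))%R). set (e2 := Rmin 1 (eps / (2 * B1))).
  assert (He1 : (0 < e1)%R) by (apply Rdiv_lt_0_compat; lra).
  assert (He2 : (0 < e2)%R) by (apply Rmin_glb_lt; [lra | apply Rdiv_lt_0_compat; lra]).
  destruct (H1 s0 Hs0 e1 He1) as (d3 & Hd3 & K3).
  destruct (H2 s0 Hs0 e2 He2) as (d4 & Hd4 & K4).
  exists (Rmin (Rmin d1 d2) (Rmin d3 d4)); split.
  { repeat apply Rmin_glb_lt; assumption. }
  intros s t q Is It Iq Hs Ht Hq.
  apply Rmin_Rgt_l in Hs as [Hs12 Hs34], Ht as [Ht12 Ht34], Hq as [Hq12 Hq34].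
  apply Rmin_Rgt_l in Hs34 as [Hs3 Hs4], Ht34 as [Ht3 Ht4], Hq34 as [Hq3 Hq4],
    Hq12 as [Hq1 Hq2].
  specialize (K1 q Iq Hq1). specialize (K2 q Iq Hq2).
  specialize (K3 s t q Is It Iq Hs3 Ht3 Hq3). specialize (K4 s t q Is It Iq Hs4 Ht4 Hq4).
  replace (Phi t - Phi s - phi q * psi q * (W t - W s)) with
    ((Phi t - Phi s - phi q * (l t - l s)) +
     phi q * (l t - l s - psi q * (W t - W s))) by ring.
  eapply Rle_trans; [apply Cmod_triangle|]. rewrite Cmod_mult.
  assert (E2 : (e2 <= 1)%R) by apply Rmin_l.
  assert (E3 : (B1 * e2 <= eps / 2)%R).
  { apply Rle_trans with (B1 * (eps / (2 * B1)))%R.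
    - apply Rmult_le_compat_l; [lra | apply Rmin_r].
    - right; field; lra. }
  assert (E1 : (e1 * (B2 + 1) = eps / 2)%R) by (unfold e1; field; lra).
  assert (R : (Cmod (l t - l s) <= (B2 + 1) * Cmod (W t - W s))%R).
  { replace (l t - l s) with (psi q * (W t - W s) + (l t - l s - psi q * (W t - W s)))
      by ring.
    eapply Rle_trans; [apply Cmod_triangle|]. rewrite Cmod_mult.
    pose proof (Cmod_ge_0 (W t - W s)). nra. }
  pose proof (Cmod_ge_0 (W t - W s)) as Hy.
  set (y := Cmod (W t - W s)) in *.
  apply Rle_trans with (e1 * ((B2 + 1) * y) + B1 * (e2 * y))%R; [|nra].
  apply Rplus_le_compat.
  - eapply Rle_trans; [exact K3|]. apply Rmult_le_compat_l; lra.
  - apply Rmult_le_compat; try apply Cmod_ge_0; assumption.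
Qed.

(** * Logarithms along a curve *)

Lemma Cmod_le_sum (z : C) : (Cmod z <= Rabs (fst z) + Rabs (snd z))%R.
Proof.
  replace z with (RtoC (fst z) + Ci * RtoC (snd z)) at 1.
  - eapply Rle_trans; [apply Cmod_triangle|].
    rewrite Cmod_mult, Cmod_Ci, !Cmod_R. lra.
  - destruct z; unfold Cplus, Cmult, Ci, RtoC; simpl; f_equal; ring.
Qed.

Lemma within_I01 (P : R -> Prop) s0 :
  within I01 (locally s0) P ->
  exists delta : R, (0 < delta)%R /\ forall s, I01 s -> (Rabs (s - s0) < delta)%R -> P s.
Proof.
  intros [d Hd]; exists d; split; [apply cond_pos|]. intros s Is Hs; now apply Hd.
Qed.

Lemma continuous_on_I01_C (gam : R -> C) :
  continuous_on I01 gam -> continuous_I01 gam.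
Proof.
  intros H s0 Hs0 eps Heps. specialize (H s0 Hs0).
  assert (Heps2 : (0 < eps / 2)%R) by lra.
  apply (filterlim_locally (F := within I01 (locally s0)) gam) with
    (eps := mkposreal _ Heps2) in H.
  destruct (within_I01 _ _ H) as (d & Hd & K). exists d; split; [exact Hd|].
  intros s Is Hs. specialize (K s Is Hs). destruct K as [K1 K2].
  eapply Rle_lt_trans; [apply Cmod_le_sum|].
  change (Rabs (fst (gam s) - fst (gam s0)) < eps / 2)%R in K1.
  change (Rabs (snd (gam s) - snd (gam s0)) < eps / 2)%R in K2.
  change (Rabs (fst (gam s) - fst (gam s0)) + Rabs (snd (gam s) - snd (gam s0)) < eps)%R.
  lra.
Qed.

Definition log_along (gam : R -> C) (z : C) (l : R -> C) : Prop :=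
  continuous_I01 l /\ forall s, I01 s -> gam s - z = Cexp (l s).

Lemma log_along_neq_0 gam z l s : log_along gam z l -> I01 s -> gam s - z <> 0.
Proof. intros [_ Hlog] Is; rewrite (Hlog s Is); apply Cexp_neq_0. Qed.

(** The polar form of the winding number, with ln |gam - z| as real part; the
    real part returns to its initial value because the curve is closed. *)
Lemma winding_number_log gam z n :
  closed_jordan gam -> winding_number gam z n ->
  exists l : R -> C, log_along gam z l /\ l 1%R - l 0%R = 2 * PI * IZR n * Ci.
Proof.
  intros (Hcont & Hclosed & _) (Hoff & theta & Htheta & Hpolar & Hinc).
  apply continuous_on_I01_C in Hcont.
  assert (Hpos : forall s, I01 s -> (0 < Cmod (gam s - z))%R).
  { intros s Is; apply Cmod_gt_0; intros E; apply Hoff; exists s; split; [exact Is|].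
    now apply Ceq_minus. }
  exists (fun s => (ln (Cmod (gam s - z)), theta s)); split; [split|].
  - intros s0 Is0 eps Heps.
    assert (Heps2 : (0 < eps / 2)%R) by lra.
    assert (Hln : continuity_pt ln (Cmod (gam s0 - z))).
    { apply derivable_continuous_pt; eexists; apply derivable_pt_lim_ln; now apply Hpos. }
    destruct (proj1 (continuity_pt_locally _ _) Hln (mkposreal _ Heps2)) as [e He].
    destruct (Hcont s0 Is0 e (cond_pos e)) as (d1 & Hd1 & K1).
    specialize (Htheta s0 Is0).
    apply (filterlim_locally (F := within I01 (locally s0)) theta) with
      (eps := mkposreal _ Heps2) in Htheta.
    destruct (within_I01 _ _ Htheta) as (d2 & Hd2 & K2).
    exists (Rmin d1 d2); split; [now apply Rmin_glb_lt|]. intros s Is Hs.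
    specialize (K1 s Is (Rlt_le_trans _ _ _ Hs (Rmin_l _ _))).
    specialize (K2 s Is (Rlt_le_trans _ _ _ Hs (Rmin_r _ _))).
    eapply Rle_lt_trans; [apply Cmod_le_sum|]. simpl.
    change (Rabs (theta s - theta s0) < eps / 2)%R in K2.
    assert (K3 : (Rabs (ln (Cmod (gam s - z)) - ln (Cmod (gam s0 - z))) < eps / 2)%R).
    { apply He. change (Rabs (Cmod (gam s - z) - Cmod (gam s0 - z)) < e)%R.
      eapply Rle_lt_trans; [|exact K1].
      replace (gam s - gam s0) with ((gam s - z) - (gam s0 - z)) by ring.
      apply Rabs_le_between'. split.
      - assert (T := Cmod_triangle (gam s - z) (- (gam s - z - (gam s0 - z)))).
        rewrite Cmod_opp in T.
        replace (_ + - _) with (gam s0 - z) in T by ring. lra.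
      - assert (T := Cmod_triangle (gam s0 - z) (gam s - z - (gam s0 - z))).
        replace (gam s0 - z + _) with (gam s - z) in T by ring. lra. }
    unfold Rminus in K2, K3. lra.
  - intros s Is. rewrite (Hpolar s Is) at 1. unfold Cexp; simpl.
    rewrite exp_ln by now apply Hpos.
    unfold Cmult; simpl.
    replace (0 * theta s - 1 * 0)%R with 0%R by ring.
    replace (0 * 0 + 1 * theta s)%R with (theta s) by ring.
    rewrite exp_0. f_equal; ring.
  - rewrite <- Hclosed. apply injective_projections; simpl; [ring|].
    rewrite <- (Rplus_0_r (theta 1%R)). unfold Rminus in Hinc.
    rewrite Rplus_0_r, Hinc. ring.
Qed.

(** * Residues of the exponential over powers *)

(** The coefficient exp (- l) is 1 / (gam - z); in this form its continuity is
    immediate. *)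
Lemma is_differential_log gam z l : log_along gam z l ->
  is_differential l (fun s => Cexp (- (1) * l s)) gam.
Proof.
  intros [Hl Hlog].
  apply (is_differential_inverse gam (fun s => Cexp (l s))).
  - intros s0 Is0 eps Heps.
    destruct (is_differential_exp l Hl s0 Is0 eps Heps) as (d & Hd & K).
    exists d; split; [exact Hd|]. intros s t q Is It Iq Hs Ht Hq.
    specialize (K s t q Is It Iq Hs Ht Hq). rewrite <- (Hlog t It), <- (Hlog s Is) in K.
    now replace (gam t - gam s) with (gam t - z - (gam s - z)) by ring.
  - now apply continuous_I01_exp, continuous_I01_scal.
  - intros s _. rewrite <- Cexp_plus.
    transitivity (Cexp 0); [f_equal; ring | exact Cexp_0].
Qed.

Lemma is_differential_Cexp_log gam z l (a : C) : log_along gam z l ->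
  is_differential (fun s => Cexp (a * l s))
    (fun s => a * Cexp (a * l s) * Cexp (- (1) * l s)) gam.
Proof.
  intros H; destruct (H) as [Hl Hlog].
  assert (Ca := continuous_I01_exp _ (continuous_I01_scal a l Hl)).
  assert (C1 := continuous_I01_exp _ (continuous_I01_scal (- (1)) l Hl)).
  apply (is_differential_comp _ (fun s => a * Cexp (a * l s)) l); auto.
  - intros s0 Is0 eps Heps. pose proof (Cmod_ge_0 a) as Ha.
    destruct (is_differential_exp _ (continuous_I01_scal a l Hl) s0 Is0
      (eps / (Cmod a + 1))%R) as (d & Hd & K); [apply Rdiv_lt_0_compat; lra|].
    exists d; split; [exact Hd|]. intros s t q Is It Iq Hs Ht Hq.
    specialize (K s t q Is It Iq Hs Ht Hq).
    replace (a * l t - a * l s) with (a * (l t - l s)) in K by ring.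
    replace (a * Cexp (a * l q) * (l t - l s)) with
      (Cexp (a * l q) * (a * (l t - l s))) by ring.
    eapply Rle_trans; [exact K|]. rewrite Cmod_mult.
    pose proof (Cmod_ge_0 (l t - l s)) as Hx. set (x := Cmod (l t - l s)) in *.
    apply Rle_trans with (eps / (Cmod a + 1) * ((Cmod a + 1) * x))%R.
    + apply Rmult_le_compat_l; [|nra]. apply Rlt_le, Rdiv_lt_0_compat; lra.
    + right; field; lra.
  - now apply (is_differential_log gam z).
  - exact (continuous_I01_scal a _ Ca).
Qed.

(** For n <> p, exp ((n - p) l) = (gam - z)^(n - p) is a closed primitive up to
    the factor n - p. For n = p the primitive is l itself, whose increment is
    2 pi i times the winding number. *)
Lemma line_integral_power gam z l n p :
  rectifiable gam -> gam 0%R = gam 1%R -> log_along gam z l ->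
  is_line_integral gam (fun t => (t - z) ^ n / (t - z) ^ S p)
    (if Nat.eqb n p then l 1%R - l 0%R else 0).
Proof.
  intros Hrect Hclosed H; destruct (H) as [Hl Hlog].
  assert (off : forall s, I01 s -> gam s - z <> 0)
    by (intros s; now apply (log_along_neq_0 gam z l)).
  assert (I0 : I01 0) by (unfold I01; lra). assert (I1 : I01 1) by (unfold I01; lra).
  assert (Hinv : forall s, I01 s -> Cexp (- (1) * l s) = / (gam s - z)).
  { intros s Is. transitivity (Cexp (- (1) * l s + l s) / (gam s - z)).
    - rewrite Cexp_plus, <- (Hlog s Is). field; now apply off.
    - replace (- (1) * l s + l s) with (RtoC 0) by ring. rewrite Cexp_0. apply Cmult_1_l. }
  destruct (Nat.eqb_spec n p) as [->|Hne].
  - apply (is_line_integral_ext gam (fun t => / (t - z))).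
    + intros s Is; simpl; field; split; [apply Cpow_nz|]; now apply off.
    + apply is_line_integral_differential; [exact Hrect|].
      intros s0 Is0 eps Heps.
      destruct (is_differential_log gam z l H s0 Is0 eps Heps) as (d & Hd & K).
      exists d; split; [exact Hd|]. intros s t q Is It Iq Hs Ht Hq.
      rewrite <- Hinv by exact Iq. now apply K.
  - set (a := RtoC (INR n) - RtoC (INR p)).
    assert (Ha : a <> 0).
    { intros E; apply Ceq_minus, RtoC_inj, INR_eq in E; contradiction. }
    assert (Hpow : forall s, I01 s -> Cexp (a * l s) = (gam s - z) ^ n / (gam s - z) ^ p).
    { intros s Is. assert (Hp := Cpow_nz _ p (off s Is)).
      transitivity (Cexp (a * l s) * Cexp (RtoC (INR p) * l s) / (gam s - z) ^ p).
      - rewrite Cexp_INR, <- (Hlog s Is). field; exact Hp.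
      - rewrite <- Cexp_plus. replace (a * l s + _) with (RtoC (INR n) * l s)
          by (unfold a; ring).
        now rewrite Cexp_INR, <- (Hlog s Is). }
    replace (RtoC 0) with (/ a * (Cexp (a * l 1%R) - Cexp (a * l 0%R))).
    2:{ rewrite !Hpow by assumption. rewrite Hclosed. ring. }
    apply (is_line_integral_ext gam
      (fun t => / a * (a * ((t - z) ^ n / (t - z) ^ S p)))).
    { intros s Is; field; split; [apply (Cpow_nz _ (S p)), off, Is | exact Ha]. }
    apply is_line_integral_scal.
    apply (is_line_integral_differential gam _ (fun s => Cexp (a * l s)) Hrect).
    intros s0 Is0 eps Heps.
    destruct (is_differential_Cexp_log gam z l a H s0 Is0 eps Heps) as (d & Hd & K).
    exists d; split; [exact Hd|]. intros s t q Is It Iq Hs Ht Hq.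
    specialize (K s t q Is It Iq Hs Ht Hq). cbv beta in K.
    rewrite (Hpow q Iq), (Hinv q Iq) in K.
    replace (a * ((gam q - z) ^ n / (gam q - z) ^ S p)) with
      (a * ((gam q - z) ^ n / (gam q - z) ^ p) * / (gam q - z)); [exact K|].
    simpl; field; split; [apply Cpow_nz|]; now apply off.
Qed.

(** Of the Taylor terms, only the one of index p meets the exponent -1. *)
Lemma line_integral_exp_taylor gam z l p N :
  rectifiable gam -> gam 0%R = gam 1%R -> log_along gam z l ->
  is_line_integral gam (fun t => (Cexp (t - z) - exp_rem N (t - z)) / (t - z) ^ S p)
    (if Nat.ltb p N then (l 1%R - l 0%R) / RtoC (INR (fact p)) else 0).
Proof.
  intros Hrect Hclosed H; induction N as [|N IH].
  - apply (is_line_integral_ext gam (fun _ => 0)); [|apply is_line_integral_0].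
    intros s _; simpl. unfold Cdiv; ring.
  - apply (is_line_integral_ext gam (fun t =>
      (Cexp (t - z) - exp_rem N (t - z)) / (t - z) ^ S p +
      / RtoC (INR (fact N)) * ((t - z) ^ N / (t - z) ^ S p))).
    { intros s Is. change (exp_rem (S N) (gam s - z)) with
        (exp_rem N (gam s - z) - (gam s - z) ^ N / RtoC (INR (fact N))).
      unfold Cdiv; ring. }
    replace (if Nat.ltb p (S N) then _ else _) with
      ((if Nat.ltb p N then (l 1%R - l 0%R) / RtoC (INR (fact p)) else 0) +
       / RtoC (INR (fact N)) * (if Nat.eqb N p then l 1%R - l 0%R else 0)).
    + apply is_line_integral_plus; [exact IH|].
      now apply is_line_integral_scal, line_integral_power.
    + destruct (Nat.ltb_spec p N), (Nat.ltb_spec p (S N)), (Nat.eqb_spec N p);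
        try lia; subst; unfold Cdiv; ring.
Qed.

(** The Taylor remainder of order > p is divisible by (t - z)^(p + 1), with a
    bound on the quotient that does not involve the distance from z to the curve
    and tends to 0. *)
Lemma line_integral_exp_pole gam z l p :
  rectifiable gam -> gam 0%R = gam 1%R -> log_along gam z l ->
  is_line_integral gam (fun t => Cexp t / (t - z) ^ S p)
    (Cexp z * ((l 1%R - l 0%R) / RtoC (INR (fact p)))).
Proof.
  intros Hrect Hclosed H.
  apply (is_line_integral_ext gam (fun t => Cexp z * (Cexp (t - z) / (t - z) ^ S p))).
  { intros s Is. replace (Cexp (gam s)) with (Cexp z * Cexp (gam s - z)).
    - unfold Cdiv; ring.
    - rewrite <- Cexp_plus; f_equal; ring. }
  apply is_line_integral_scal, (is_line_integral_uniform_limit _ _ _ Hrect).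
  intros eps Heps.
  assert (HM : exists M : R, forall s, I01 s -> (Cmod (gam s - z) <= M)%R).
  { (* the partition 0, s, 1 bounds |gam s - gam 0| by the length *)
    destruct Hrect as [L HL]. exists (Cmod (gam 0%R - z) + L)%R. intros s Is.
    assert (Hp := HL 1%nat (fun i => match i with O => 0 | 1%nat => s | _ => 1 end)%R).
    rewrite sum_Sn, sum_O in Hp. unfold plus in Hp; simpl in Hp.
    assert (Hle := Hp ltac:(repeat split; intros [|[|i]] Hi; unfold I01 in Is; lra || lia)).
    pose proof (Cmod_ge_0 (gam 1%R - gam s)).
    replace (gam s - z) with (gam 0%R - z + (gam s - gam 0%R)) by ring.
    eapply Rle_trans; [apply Cmod_triangle|]. lra. }
  destruct HM as [M HM].
  assert (HM0 : (0 <= M)%R) by (eapply Rle_trans; [apply Cmod_ge_0 | apply (HM 0%R); unfold I01; lra]).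
  pose proof (exp_pos M) as HeM.
  (* m is the degree left in the bound after division by |t - z|^(p + 1) *)
  destruct (cv_speed_pow_fact M (eps / exp M)%R) as [m Hm];
    [apply Rdiv_lt_0_compat; lra|].
  specialize (Hm m (le_n m)). unfold Rdist in Hm. rewrite Rminus_0_r in Hm.
  exists (fun t => (Cexp (t - z) - exp_rem (S p + m) (t - z)) / (t - z) ^ S p). split.
  - assert (T := line_integral_exp_taylor gam z l p (S p + m) Hrect Hclosed H).
    now replace (Nat.ltb p (S p + m)) with true in T
      by (symmetry; apply Nat.ltb_lt; lia).
  - intros s Is. set (w := gam s - z).
    assert (Hw : (0 < Cmod w)%R) by now apply Cmod_gt_0, (log_along_neq_0 gam z l).
    assert (Hwp : (0 < Cmod w ^ S p)%R) by now apply pow_lt.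
    replace (_ - _) with (exp_rem (S p + m) w / w ^ S p) by (unfold Cdiv; ring).
    rewrite Cmod_div by now apply Cpow_nz, (log_along_neq_0 gam z l). rewrite Cmod_pow.
    apply (Rmult_le_reg_r (Cmod w ^ S p)); [exact Hwp|].
    unfold Rdiv; rewrite Rmult_assoc, Rinv_l, Rmult_1_r by lra.
    eapply Rle_trans; [apply exp_rem_bound|].
    assert (HwM : (Cmod w <= M)%R) by now apply HM.
    assert (Hfm : (0 < INR (fact m))%R) by apply INR_fact_lt_0.
    assert (Hf : (INR (fact m) <= INR (fact (S p + m)))%R) by (apply le_INR, fact_le; lia).
    apply Rle_trans with (exp M * (Cmod w ^ S p * M ^ m) / INR (fact m))%R.
    + unfold Rdiv. apply Rmult_le_compat.
      * apply Rmult_le_pos; [left; apply exp_pos | apply pow_le; lra].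
      * left; apply Rinv_0_lt_compat; lra.
      * apply Rmult_le_compat; [left; apply exp_pos | apply pow_le; lra
          | now apply exp_monotone |].
        rewrite pow_add. apply Rmult_le_compat_l; [lra|]. apply pow_incr; lra.
      * apply Rinv_le_contravar; assumption.
    + assert (Hq : (M ^ m / INR (fact m) <= eps / exp M)%R).
      { left; eapply Rle_lt_trans; [apply Rle_abs | exact Hm]. }
      apply Rle_trans with (exp M * Cmod w ^ S p * (eps / exp M))%R.
      * replace (exp M * (Cmod w ^ S p * M ^ m) / INR (fact m))%R with
          (exp M * Cmod w ^ S p * (M ^ m / INR (fact m)))%R by (field; lra).
        apply Rmult_le_compat_l; [|exact Hq]. apply Rmult_le_pos; lra.
      * right; field; lra.
Qed.

(** * The contour integral and the family of solutions *)

Lemma wave_contour_integral (x : nat -> C) gam r :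
  closed_jordan gam -> rectifiable gam -> winding_number gam (x 0%nat) 1 ->
  is_line_integral gam (fun t => Cexp t * Afun x r t) (2 * PI * Ci * wave x r).
Proof.
  intros Hj Hrect Hw.
  destruct (winding_number_log gam _ _ Hj Hw) as (l & Hlog & Hinc).
  apply (is_line_integral_ext gam (fun t => sum_n (fun s =>
    fpow (ftail x) s r * (Cexp t / (t - x 0%nat) ^ S s)) r)).
  - intros s Is. rewrite (Afun_expansion x (gam s) r r).
    + rewrite <- Csum_n_scal. apply Csum_n_ext; intros i _; unfold Cdiv; ring.
    + intros E. apply (Cexp_neq_0 (l s)). rewrite <- (proj2 Hlog s Is), E. ring.
    + lia.
  - replace (2 * PI * Ci * wave x r) with (sum_n (fun s => fpow (ftail x) s r *
      (Cexp (x 0%nat) * ((l 1%R - l 0%R) / RtoC (INR (fact s))))) r).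
    + apply is_line_integral_sum; intros i _. apply is_line_integral_scal.
      apply line_integral_exp_pole; try assumption. apply Hj.
    + unfold wave. rewrite (Apoly_expansion x r r) by lia.
      rewrite <- !Csum_n_scal. apply Csum_n_ext; intros i _.
      rewrite Hinc. unfold Cdiv; ring.
Qed.

Theorem mainTheorem1 (mm : C) :
  (* m, g, d are arbitrary and k is determined by the system, whose first
     equation is quadratic in k_0 and whose r-th equation is linear in k_r
     with coefficient 2 k_0 *)
  (forall m g d : nat -> C,
     (exists k0 : C,
        k0 ^ 2 - m 0%nat ^ 2 - g 0%nat ^ 2 - d 0%nat ^ 2 + mm = 0) /\
     (forall k0 : C,
        k0 ^ 2 - m 0%nat ^ 2 - g 0%nat ^ 2 - d 0%nat ^ 2 + mm = 0 ->
        k0 <> 0 ->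
        exists k : nat -> C,
          (k 0%nat = k0 /\ KG_system mm k m g d) /\
          (forall k' : nat -> C,
             k' 0%nat = k0 /\ KG_system mm k' m g d ->
             forall r, k' r = k r))) /\
  (forall k m g d : nat -> C, KG_system mm k m g d ->
     forall r : nat,
       solves_KG mm (KG_U k m g d r) /\
       (forall (x0 x1 x2 x3 : R) (gam : R -> C),
          closed_jordan gam -> rectifiable gam -> positively_oriented gam ->
          surrounds gam (xi k m g d x0 x1 x2 x3 0) ->
          exists J : C,
            is_line_integral gam
              (fun t => Cexp t * Afun (xi k m g d x0 x1 x2 x3) r t) J /\
            KG_U k m g d r x0 x1 x2 x3 = / (2 * PI * Ci) * J) /\
       ((1 <= r)%nat -> forall x0 x1 x2 x3 : R,
          is_P (xi k m g d x0 x1 x2 x3 0) (r + 1)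
            (Afun (xi k m g d x0 x1 x2 x3) r)
            (Apoly (xi k m g d x0 x1 x2 x3) r))) /\
  (exists k m g d : nat -> C,
     KG_system mm k m g d /\
     infinite_dimensional
       (fun U => exists r : nat, U = KG_U k m g d r)).
Proof.
  split; [|split].
  - intros m g d; split.
    + destruct (Csqrt_exists (m 0%nat ^ 2 + g 0%nat ^ 2 + d 0%nat ^ 2 - mm)) as [k0 Hk0].
      exists k0; rewrite Hk0; ring.
    + intros k0 H0 Hk0; now apply KG_system_solvable.
  - intros k m g d HS r; split; [|split].
    + now apply KG_U_solves.
    + intros x0 x1 x2 x3 gam Hj Hrect Hor Hsur.
      eexists; split; [apply wave_contour_integral; auto|].
      change (KG_U k m g d r x0 x1 x2 x3) with (wave (xi k m g d x0 x1 x2 x3) r).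
      field. split.
      * intros E; apply (f_equal snd) in E; simpl in E; lra.
      * intros E; apply RtoC_inj in E; pose proof PI_RGT_0; lra.
    + intros Hr x0 x1 x2 x3; now apply Afun_is_P.
  - apply infinite_dimensional_family.
Qed.
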